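(* Let $\mathcal A$ be a unital C$^*$-algebra. (1) The subgroup $\mathcal B$ acts freely and transitively on $\mathcal K_H$ (by left multiplication). In particular, $\mathcal U(\theta_H)$ acts transitively on $\mathcal K_H$. (2) $\mathcal K_H$ is a $C^\infty$ submanifold of $\mathcal A^2$. (3) The map $\varphi:\mathcal K_H\to\mathcal H$, $\varphi\left(\begin{array}{c} x_1\\ x_2\end{array}\right)=x_2x_1^{-1}$, is a $C^\infty$ epimorphism (i.e. a surjective $C^\infty$ map), with a global $C^\infty$ cross section. (4) The group $\mathcal U(\theta_H)$ acts covariantly with respect to $\varphi$ (on the left): if $\tilde a\in\mathcal U(\theta_H)$ and $\left(\begin{array}{c} b_1\\ b_2\end{array}\right)\in\mathcal K_H$, then $$\varphi\left(\tilde a\left(\begin{array}{c} b_1\\ b_2\end{array}\right)\right)=\tilde a\cdot\varphi\left(\begin{array}{c} b_1\\ b_2\end{array}\right).$$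
   Context: $G$ is the group of invertible elements of $\mathcal A$, $G^+$ the set of positive invertible elements, $Im(h)=\frac1{2i}(h-h^* )$, and $\mathcal H=\{h\in\mathcal A: Im(h)\in G^+\}$, an open subset of $\mathcal A$. $M_2(\mathcal A)$ acts by left multiplication on column vectors in $\mathcal A^2$, and $Gl_2(\mathcal A)$ is the group of invertible elements of $M_2(\mathcal A)$. The $\mathcal A$-valued form $\theta_H$ on $\mathcal A^2$ is $\theta_H\left(\left(\begin{array}{c} x_1\\ x_2\end{array}\right),\left(\begin{array}{c} y_1\\ y_2\end{array}\right)\right)=\frac1i(x_1^*y_2-x_2^*y_1)$, and $$\mathcal U(\theta_H)=\{\tilde a\in Gl_2(\mathcal A):\theta_H(\tilde a\mathbf x,\tilde a\mathbf y)=\theta_H(\mathbf x,\mathbf y)\ \text{for all }\mathbf x,\mathbf y\in\mathcal A^2\},$$ $$\mathcal K_H=\{\mathbf x=(x_1,x_2)^T\in\mathcal A^2:\theta_H(\mathbf x,\mathbf x)=1,\ x_1\in G\}.$$ $\mathcal B$ is the group of all elements of $\mathcal U(\theta_H)$ of the form $\left(\begin{array}{cc}b_{11}&0\\ b_{21}&b_{22}\end{array}\right)$. $\mathcal U(\theta_H)$ acts on $\mathcal K_H$ by left multiplication, and on $\mathcal H$ by $$\left(\begin{array}{cc}a_{11}&a_{12}\\ a_{21}&a_{22}\end{array}\right)\cdot h=(a_{21}+a_{22}h)(a_{11}+a_{12}h)^{-1}.$$ Manifolds are real $C^\infty$ Banach manifolds. *)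

(* Defs.v *)
From HB Require Import structures.
From mathcomp Require Import all_boot all_order all_algebra.
From mathcomp Require Import all_classical all_reals all_analysis.
From mathcomp Require Import complex.

Set Implicit Arguments.
Unset Strict Implicit.
Unset Printing Implicit Defensive.

Import Order.TTheory GRing.Theory Num.Theory.
Import numFieldNormedType.Exports.

Local Open Scope classical_set_scope.
Local Open Scope ring_scope.
Local Open Scope complex_scope.

(* `|c| is the modulus of c as an element of R[i], hence the real part. *)
HB.mixin Record UnitAlgebra_isCStarAlgebra (R : realType) A
    of GRing.UnitAlgebra R[i] A := {
  cnorm : A -> R ;
  star : A -> A ;
  cnormD : forall x y : A, cnorm (x + y) <= cnorm x + cnorm y ;
  cnormZ : forall (c : R[i]) (x : A), cnorm (c *: x) = complex.Re `|c| * cnorm x ;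
  cnorm0_eq0 : forall x : A, cnorm x = 0 -> x = 0 ;
  cnorm_complete : forall u : nat -> A,
    (forall e, 0 < e -> exists N, forall m n,
       (N <= m)%N -> (N <= n)%N -> cnorm (u m - u n) < e) ->
    exists l, forall e, 0 < e -> exists N, forall n,
       (N <= n)%N -> cnorm (u n - l) < e ;
  cnormM : forall x y : A, cnorm (x * y) <= cnorm x * cnorm y ;
  starK : involutive star ;
  starD : {morph star : x y / x + y} ;
  starZ : forall (c : R[i]) (x : A), star (c *: x) = c^* *: star x ;
  starM : forall x y : A, star (x * y) = star y * star x ;
  cnorm_starM : forall x : A, cnorm (star x * x) = cnorm x ^+ 2
}.

#[short(type="cstarAlgType")]
HB.structure Definition CStarAlgebra (R : realType) :=
  {A of GRing.UnitAlgebra R[i] A & UnitAlgebra_isCStarAlgebra R A}.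

(* The real Banach space underlying a C*-algebra. *)
Definition realified (R : realType) (A : cstarAlgType R) : Type := A.

Section Realified.
Context (R : realType) (A : cstarAlgType R).

HB.instance Definition _ := GRing.Zmodule.on (realified A).

Definition real_scale (a : R) (x : realified A) : realified A :=
  (a%:C *: (x : A)).

Fact real_scaleA a b x : real_scale a (real_scale b x) = real_scale (a * b) x.
Proof. by rewrite /real_scale scalerA -rmorphM. Qed.

Fact real_scale1 : left_id 1 real_scale.
Proof. by move=> x; rewrite /real_scale rmorph1 scale1r. Qed.

Fact real_scaleDr : right_distributive real_scale +%R.
Proof. by move=> a x y; exact: (@scalerDr _ A). Qed.

Fact real_scaleDl x : {morph real_scale^~ x : a b / a + b}.
Proof. by move=> a b; rewrite /real_scale rmorphD scalerDl. Qed.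

HB.instance Definition _ := GRing.Zmodule_isLmodule.Build R (realified A)
  real_scaleA real_scale1 real_scaleDr real_scaleDl.

Definition real_norm (x : realified A) : R := cnorm (x : A).

Fact real_normD x y : real_norm (x + y) <= real_norm x + real_norm y.
Proof. exact: (@cnormD _ A). Qed.

Fact real_normZ (a : R) x : real_norm (a *: x) = `|a| * real_norm x.
Proof.
by rewrite /real_norm [LHS](@cnormZ _ A) normc_def /= expr0n addr0 sqrtr_sqr.
Qed.

Fact real_norm0_eq0 x : real_norm x = 0 -> x = 0.
Proof. exact: (@cnorm0_eq0 _ A). Qed.

HB.instance Definition _ := @Lmodule_isNormed.Build R (realified A)
  real_norm real_normD real_normZ real_norm0_eq0.

Fact realified_complete (F : set_system (realified A)) :
  ProperFilter F -> cauchy F -> cvg F.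
Proof.
move=> FF /cauchyP Fc.
have uP n : exists x : realified A, F (ball x (n.+1%:R^-1 : R)).
  by apply: Fc; rewrite invr_gt0.
have /choice[u Fu] := uP.
have small (e : R) : 0 < e -> exists N, forall n, (N <= n)%N ->
    (n.+1%:R^-1 : R) < e.
  move=> e0; have [N _ Nn] : \forall n \near \oo, (n.+1%:R^-1 : R) < e.
    by near=> n; near: n; exact: near_infty_natSinv_lt (PosNum e0).
  by exists N => n /Nn.
have uE n (x : realified A) : ball (u n) (n.+1%:R^-1 : R) x ->
  `|u n - x| < n.+1%:R^-1 by rewrite -ball_normE.
have [e e0|l ul] := @cnorm_complete _ A u.
  have [N Ne] := small (e / 2) (divr_gt0 e0 (ltr0n _ 2)).
  exists N => m n Nm Nn.
  have [x [/uE mx /uE nx]] := filter_ex (filterI (Fu m) (Fu n)).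
  rewrite (_ : cnorm _ = `|u m - u n|)// -(subrK x (u m)) -addrA.
  rewrite (le_lt_trans (ler_normD _ _))// [e]splitr ltrD//.
    by rewrite (lt_trans mx)// Ne.
  by rewrite distrC (lt_trans nx)// Ne.
apply/cvg_ex; exists (l : realified A); apply/cvgrPdist_lt => e e0.
have [N1 Ne] := small (e / 2) (divr_gt0 e0 (ltr0n _ 2)).
have [N2 Nl] := ul (e / 2) (divr_gt0 e0 (ltr0n _ 2)).
pose n := maxn N1 N2.
apply: filterS (Fu n) => x /uE nx.
rewrite -(subrK (u n) l) -addrA (le_lt_trans (ler_normD _ _))//.
rewrite [e]splitr ltrD//.
  by rewrite distrC; apply: Nl; rewrite leq_maxr.
by rewrite (lt_trans nx)// Ne// leq_maxl.
Unshelve. all: by end_near. Qed.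

HB.instance Definition _ :=
  Uniform_isComplete.Build (realified A) realified_complete.

End Realified.

(* Completes the joins of structures that the library leaves out for products. *)
HB.instance Definition _ (E F : puniformType) := Pointed.on (E * F)%type.

Section ProductComplete.
Context (R : realType) (E F : completeNormedModType R).

Fact prod_complete (G : set_system (E * F)) :
  ProperFilter G -> cauchy G -> cvg G.
Proof.
move=> GG /cauchyP Gc.
have c1 : cauchy (fst @ G).
  apply/cauchyP => e /Gc[x Gx]; exists x.1.
  change (G (fst @^-1` ball x.1 e)).
  by apply: filterS Gx => y; case.
have c2 : cauchy (snd @ G).
  apply/cauchyP => e /Gc[x Gx]; exists x.2.
  change (G (snd @^-1` ball x.2 e)).
  by apply: filterS Gx => y; case.
have [a Ga] := (cvg_ex (fst @ G)).1 (@cauchy_cvg E _ _ c1).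
have [b Gb] := (cvg_ex (snd @ G)).1 (@cauchy_cvg F _ _ c2).
apply/cvg_ex; exists (a, b).
rewrite (_ : G = ((fun x => (x.1, x.2)) @ G)); first exact: cvg_pair.
by apply/seteqP; split => P; rewrite /= /nbhs /=; apply: filterS => -[].
Qed.

HB.instance Definition _ :=
  Uniform_isComplete.Build (E * F)%type prod_complete.

End ProductComplete.

(* The normed space of bounded linear operators, with the operator norm. *)
Record bounded_op (R : realType) (E F : normedModType R) := BoundedOp {
  bounded_op_fun :> E -> F ;
  bounded_op_linear : linear bounded_op_fun ;
  bounded_op_continuous : continuous bounded_op_fun }.

Section BoundedOp.
Context (R : realType) (E F : normedModType R).
Local Notation L := (bounded_op E F).

HB.instance Definition _ (f : L) :=
  GRing.isLinear.Build R E F *:%R f (bounded_op_linear f).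

Lemma bounded_op_eq (f g : L) : f =1 g -> f = g.
Proof.
case: f g => [f fl fc] [g gl gc] /= /funext fg; subst g.
by congr BoundedOp; exact: Prop_irrelevance.
Qed.

HB.instance Definition _ := gen_eqMixin L.
HB.instance Definition _ := gen_choiceMixin L.

Fact op_zero_linear : linear (fun _ : E => 0 : F).
Proof. by move=> a x y; rewrite scaler0 addr0. Qed.
Definition op_zero : L := BoundedOp op_zero_linear (fun x => cvg_cst _).

Fact op_add_linear (f g : L) : linear (fun x => f x + g x).
Proof. by move=> a x y; rewrite !linearP scalerDr addrACA. Qed.
Fact op_add_continuous (f g : L) : continuous (fun x => f x + g x).
Proof.
move=> x; apply: (@cvgD R F E (nbhs x) _ (f : E -> F) (g : E -> F));
  exact: bounded_op_continuous.
Qed.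
Definition op_add (f g : L) : L :=
  BoundedOp (@op_add_linear f g) (@op_add_continuous f g).

Fact op_scale_linear (c : R) (f : L) : linear (fun x => c *: f x).
Proof.
by move=> a x y; rewrite linearP scalerDr !scalerA [a * c]mulrC.
Qed.
Fact op_scale_continuous (c : R) (f : L) : continuous (fun x => c *: f x).
Proof.
by move=> x; apply: cvgZ; [exact: cvg_cst|exact: bounded_op_continuous].
Qed.
Definition op_scale (c : R) (f : L) : L :=
  BoundedOp (@op_scale_linear c f) (@op_scale_continuous c f).

Definition op_opp (f : L) : L := op_scale (-1) f.

Fact op_addA : associative op_add.
Proof. by move=> f g h; apply: bounded_op_eq => x /=; rewrite addrA. Qed.
Fact op_addC : commutative op_add.
Proof. by move=> f g; apply: bounded_op_eq => x /=; rewrite addrC. Qed.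
Fact op_add0 : left_id op_zero op_add.
Proof. by move=> f; apply: bounded_op_eq => x /=; rewrite add0r. Qed.
Fact op_addN : left_inverse op_zero op_opp op_add.
Proof.
by move=> f; apply: bounded_op_eq => x /=; rewrite scaleN1r addNr.
Qed.

HB.instance Definition _ :=
  GRing.isZmodule.Build L op_addA op_addC op_add0 op_addN.

Fact op_scaleA a b (f : L) : op_scale a (op_scale b f) = op_scale (a * b) f.
Proof. by apply: bounded_op_eq => x /=; rewrite scalerA. Qed.
Fact op_scale1 : left_id 1 op_scale.
Proof. by move=> f; apply: bounded_op_eq => x /=; rewrite scale1r. Qed.
Fact op_scaleDr : right_distributive op_scale +%R.
Proof. by move=> a f g; apply: bounded_op_eq => x /=; rewrite scalerDr. Qed.
Fact op_scaleDl (f : L) : {morph op_scale^~ f : a b / a + b}.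
Proof. by move=> a b; apply: bounded_op_eq => x /=; rewrite scalerDl. Qed.

HB.instance Definition _ := GRing.Zmodule_isLmodule.Build R L
  op_scaleA op_scale1 op_scaleDr op_scaleDl.

Definition op_ball (f : L) : set R :=
  [set `|f x| | x in [set x : E | `|x| <= 1]].

Definition op_norm (f : L) : R := sup (op_ball f).

Fact op_ball_nonempty (f : L) : op_ball f !=set0.
Proof. by exists `|f 0|; exists 0 => //=; rewrite normr0. Qed.

Fact op_ball_ubound (f : L) : has_ubound (op_ball f).
Proof.
have /linear_bounded_continuous/linear_boundedP := @bounded_op_continuous _ _ _ f.
move=> /pinfty_ex_gt0 [M M0 fM]; exists M => _ [x /= x1 <-].
by rewrite (le_trans (fM x))// ler_piMr// ltW.
Qed.

Fact op_ball_sup (f : L) : has_sup (op_ball f).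
Proof. by split; [exact: op_ball_nonempty|exact: op_ball_ubound]. Qed.

Lemma op_norm_bound (f : L) x : `|f x| <= op_norm f * `|x|.
Proof.
have [->|x0] := eqVneq x 0; first by rewrite linear0 !normr0 mulr0.
have nx : 0 < `|x| by rewrite normr_gt0.
rewrite -ler_pdivrMr// mulrC.
have -> : `|x|^-1 * `|f x| = `|f (`|x|^-1 *: x)|.
  by rewrite linearZ normrZ gtr0_norm ?invr_gt0.
apply: sup_upper_bound; first exact: op_ball_sup.
exists (`|x|^-1 *: x) => //=.
by rewrite normrZ gtr0_norm ?invr_gt0// mulVf ?gt_eqF.
Qed.

Lemma op_norm_ge0 (f : L) : 0 <= op_norm f.
Proof.
apply: sup_upper_bound; first exact: op_ball_sup.
by exists 0; rewrite /= ?linear0 normr0.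
Qed.

Lemma op_norm_le (f : L) (M : R) :
  (forall x, `|x| <= 1 -> `|f x| <= M) -> op_norm f <= M.
Proof.
move=> fM; apply: ge_sup; first exact: op_ball_nonempty.
by move=> _ [x /= x1 <-]; exact: fM.
Qed.

Lemma op_norm_unit (f : L) x : `|x| <= 1 -> `|f x| <= op_norm f.
Proof.
move=> x1; rewrite (le_trans (op_norm_bound f x))// ler_piMr//.
exact: op_norm_ge0.
Qed.

Fact op_normD (f g : L) : op_norm (f + g) <= op_norm f + op_norm g.
Proof.
apply: op_norm_le => x x1.
by rewrite (le_trans (ler_normD _ _))// lerD// op_norm_unit.
Qed.

Fact op_normZ_le (a : R) (f : L) : op_norm (a *: f) <= `|a| * op_norm f.
Proof.
by apply: op_norm_le => x x1; rewrite normrZ ler_wpM2l// op_norm_unit.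
Qed.

Fact op_normZ (a : R) (f : L) : op_norm (a *: f) = `|a| * op_norm f.
Proof.
apply/le_anti; rewrite op_normZ_le /=.
have [->|a0] := eqVneq a 0; first by rewrite normr0 mul0r op_norm_ge0.
rewrite -ler_pdivlMl ?normr_gt0// -normfV.
by rewrite -[X in op_norm X <= _](scale1r f) -(mulVf a0) -scalerA op_normZ_le.
Qed.

Fact op_norm0_eq0 (f : L) : op_norm f = 0 -> f = 0.
Proof.
move=> f0; apply: bounded_op_eq => x /=; apply/eqP; rewrite -normr_le0.
by rewrite (le_trans (op_norm_bound f x))// f0 mul0r.
Qed.

HB.instance Definition _ := @Lmodule_isNormed.Build R L
  op_norm op_normD op_normZ op_norm0_eq0.

End BoundedOp.

(* f is of class C^k on U if it is Frechet differentiable at every point of U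
   and its derivative, a map from U to the bounded operators with the operator
   norm, is of class C^(k-1) on U.  It is used for open sets U only. *)
Fixpoint Ck (R : realType) (E : normedModType R) (k : nat) :
    forall F : normedModType R, set E -> (E -> F) -> Prop :=
  match k with
  | 0 => fun F U f => forall x, U x -> {for x, continuous f}
  | k'.+1 => fun F U f =>
      (forall x, U x -> differentiable f x) /\
      exists Df : E -> bounded_op E F,
        (forall x, U x -> Df x = 'd f x :> (E -> F)) /\ Ck k' U Df
  end.

Definition Cinf (R : realType) (E F : normedModType R) (U : set E)
  (f : E -> F) : Prop := forall k, Ck k U f.

(* A chart of the ambient space E, with values in a product of two Banach
   spaces, that flattens S: S corresponds to the first factor. *)
Record slice_chart (R : realType) (E : completeNormedModType R) (S : set E) :=
  SliceChart {
    model : completeNormedModType R ;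
    normal : completeNormedModType R ;
    cdom : set E ;
    ccod : set (model * normal) ;
    cfun : E -> model * normal ;
    cinv : model * normal -> E ;
    cdom_open : open cdom ;
    ccod_open : open ccod ;
    cfun_cod : forall x, cdom x -> ccod (cfun x) ;
    cinv_dom : forall y, ccod y -> cdom (cinv y) ;
    cfunK : forall x, cdom x -> cinv (cfun x) = x ;
    cinvK : forall y, ccod y -> cfun (cinv y) = y ;
    cfun_Cinf : Cinf cdom cfun ;
    cinv_Cinf : Cinf ccod cinv ;
    cfun_slice : forall x, cdom x -> (S x <-> (cfun x).2 = 0) }.

Arguments ccod {R E S} s _.
Arguments cfun {R E S} s _.
Arguments cinv {R E S} s _.
Arguments cdom {R E S} s _.

(* The induced chart of S is the first component of cfun on S `&` cdom; its
   inverse is v |-> cinv (v, 0), on the open set of v with (v, 0) in ccod. *)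

Definition Cinf_submanifold (R : realType) (E : completeNormedModType R)
    (S : set E) : Prop :=
  forall x, S x -> exists c : slice_chart S, cdom c x.

(* For maps between manifolds smoothness is read in charts, as usual.  In the
   next two definitions the manifold other than S is an open subset of a Banach
   space, and is given the identity chart. *)
Definition Cinf_from_submanifold (R : realType) (E F : completeNormedModType R)
    (S : set E) (f : E -> F) : Prop :=
  forall x, S x -> exists2 c : slice_chart S, cdom c x &
    Cinf [set v : model c | ccod c (v, 0)]
         (fun v : model c => f (cinv c (v, 0))).

Definition Cinf_to_submanifold (R : realType) (E F : completeNormedModType R)
    (O : set F) (S : set E) (f : F -> E) : Prop :=
  forall h, O h -> exists (W : set F) (c : slice_chart S),
    [/\ open W, W h, W `<=` O,
        forall w, W w -> S (f w) /\ cdom c (f w) &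
        Cinf W (fun w => (cfun c (f w)).1)].

Section Algebra.
Context (R : realType) (A : cstarAlgType R).

Definition spectrum (a : A) : set R[i] :=
  [set c | (a - c%:A) \isn't a GRing.unit].

Definition positive (a : A) : Prop :=
  star a = a /\ forall c, spectrum a c -> 0 <= c.

Definition Gpos : set A := [set a | a \is a GRing.unit /\ positive a].

Definition im_part (h : A) : A := (2%:R * 'i : R[i])^-1 *: (h - star h).

Definition upper_half : set A := [set h | Gpos (im_part h)].

(* Column vectors of A^2 are represented by pairs. *)
Definition mulmv (a : 'M[A]_2) (x : A * A) : A * A :=
  (a 0 0 * x.1 + a 0 1 * x.2, a 1 0 * x.1 + a 1 1 * x.2).

Definition GL2 : set 'M[A]_2 :=
  [set a | exists b, a *m b = 1%:M /\ b *m a = 1%:M].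

Definition thetaH (x y : A * A) : A :=
  ('i : R[i])^-1 *: (star x.1 * y.2 - star x.2 * y.1).

Definition UthetaH : set 'M[A]_2 :=
  [set a | GL2 a /\
     forall x y, thetaH (mulmv a x) (mulmv a y) = thetaH x y].

Definition KH : set (A * A) :=
  [set x | thetaH x x = 1 /\ x.1 \is a GRing.unit].

Definition Borel : set 'M[A]_2 := [set b | UthetaH b /\ b 0 1 = 0].

Definition moebius (a : 'M[A]_2) (h : A) : A :=
  (a 1 0 + a 1 1 * h) * (a 0 0 + a 0 1 * h)^-1.

Definition phi (x : A * A) : A := x.2 * x.1^-1.

Definition subgroup_of (B U : set 'M[A]_2) : Prop :=
  [/\ B `<=` U, B 1%:M,
      forall a b, B a -> B b -> B (a *m b) &
      forall a, B a -> exists2 b, B b & a *m b = 1%:M /\ b *m a = 1%:M].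

(* The axioms of an action other than invariance hold for mulmv anyway. *)
Definition acts_on (B : set 'M[A]_2) (S : set (A * A)) : Prop :=
  forall b x, B b -> S x -> S (mulmv b x).

Definition acts_transitively_on (B : set 'M[A]_2) (S : set (A * A)) : Prop :=
  acts_on B S /\
  forall x y, S x -> S y -> exists2 b, B b & mulmv b x = y.

Definition acts_freely_on (B : set 'M[A]_2) (S : set (A * A)) : Prop :=
  acts_on B S /\ forall b x, B b -> S x -> mulmv b x = x -> b = 1%:M.

End Algebra.

Arguments upper_half {R} A _.
Arguments KH {R} A _.
Arguments UthetaH {R} A _.
Arguments Borel {R} A _.

(* Main.v *)
(* Elements of K_H are the (x_1, x_2) with x_1 invertible such that
   h = x_2 x_1^-1 satisfies (h - h^* ) / i = (x_1 x_1^* )^-1.  Hence (x_1, Re h)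
   are global coordinates on K_H, the last coordinate of the flattening chart being
   Im h - (x_1 x_1^* )^-1 / 2, and h |-> (p^(-1/2), h p^(-1/2)) with p = (h - h^* ) / i is
   a global section of phi.  A lower triangular b in U(theta_H) carrying x to y
   is forced on the diagonal by b_11 = y_1 x_1^-1, which gives (1).

   U(theta_H) preserves K_H because it maps (1, i/2) to a vector whose first
   entry d has both d^* d and d d^* bounded below: if z^* k + k^* z = 1, then
   0 <= (z - t k)^* (z - t k) yields z^* z >= t - t^2 k^* k.

   The C^*-algebra input is that a^* a is positive, that positive elements have
   square roots, and that the norm of a self-adjoint element is controlled by
   its spectrum.  For the latter, if 1 - z x is invertible on the closed unit
   disc, then averaging resolvents over z and -z repeatedly shows that
   (1 - x^N)^-1 is uniformly close to 1 along N = 2^k, while |x^N| = |x|^N.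
   The square root is smooth since its derivative at a is the inverse of
   X |-> bX + Xb with b^2 = a, and inversion of operators is smooth. *)

Require Import Defs.
From HB Require Import structures.
From mathcomp Require Import all_boot all_order all_algebra.
From mathcomp Require Import all_classical all_reals all_analysis.
From mathcomp Require Import complex ring lra.
From Stdlib Require Ncring Ncring_tac.

Set Implicit Arguments.
Unset Strict Implicit.
Unset Printing Implicit Defensive.

Import Order.TTheory GRing.Theory Num.Theory.
Import numFieldNormedType.Exports.

Local Open Scope classical_set_scope.
Local Open Scope ring_scope.
Local Open Scope complex_scope.

(** Positivity is defined through the spectrum, which says nothing about sums. The bridge is the
    spectral bound: a self-adjoint a is positive exactly when |t - a| <= t for some real t, a
    condition on norms that adds up. Square roots start from it as well: it makes a = t (1 - w) with
    |w| <= 1, and the root of 1 - w is the limit of an iteration.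

    The strict form |t - a| < t cuts out an open subset of A, containing elements that are not
    self-adjoint, on which the root is still unique. Derivatives can therefore be taken in
    [realified A] instead of along the positive elements.

    In [Ck] the codomain changes at each derivative. The sum, product and chain rules are therefore
    proved by induction on k with the codomain left general, and the product rule is stated for
    arbitrary bounded bilinear maps, since the derivative of such a product is a sum of two more of
    them. *)

#[global] Instance ncring_ops (A : pzRingType) : @Ncring.Ring_ops A 0 1 (@GRing.add A) (@GRing.mul A) (fun x y => x - y) (@GRing.opp A) (@eq A) := {}.
#[global] Instance ncring (A : pzRingType) : @Ncring.Ring A 0 1 (@GRing.add A) (@GRing.mul A) (fun x y => x - y) (@GRing.opp A) (@eq A) (ncring_ops A).
Proof.
split.
- exact: RelationClasses.eq_equivalence.
- by move=> ? ? -> ? ? ->.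
- by move=> ? ? -> ? ? ->.
- by move=> ? ? -> ? ? ->.
- by move=> ? ? ->.
- exact: add0r.
- exact: addrC.
- exact: addrA.
- exact: mul1r.
- exact: mulr1.
- exact: mulrA.
- exact: mulrDl.
- move=> x y z; exact: mulrDr.
- by [].
- exact: addrN.
Qed.
(** Scalings, inverses and stars are atoms for this tactic, so they are expanded by rewriting before
    it is called. *)
Ltac nring := Ncring_tac.non_commutative_ring.

(** * Norm, involution and invertibility in a C*-algebra *)

Section CStarBasics.
Context (R : realType) (A : cstarAlgType R).
Implicit Types (x y a b u w : A) (t : R) (c : R[i]).

Lemma cnorm0 : cnorm (0 : A) = 0.
Proof. exact: (@normr0 _ (realified A)). Qed.

Lemma cnorm_ge0 x : 0 <= cnorm x.
Proof. exact: (@normr_ge0 _ (realified A)). Qed.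

Lemma cdistC x y : cnorm (x - y) = cnorm (y - x).
Proof. exact: (@distrC _ (realified A)). Qed.

Lemma cnormB x y : cnorm (x - y) <= cnorm x + cnorm y.
Proof. exact: (@ler_normB _ (realified A)). Qed.

Lemma cnormZr t x : cnorm (t%:C *: x) = `|t| * cnorm x.
Proof. exact: (@real_normZ R A). Qed.

Lemma cnormZi x : cnorm (('i : R[i]) *: x) = cnorm x.
Proof.
by rewrite cnormZ -complexiE normc_def /= expr0n expr1n add0r sqrtr1 mul1r.
Qed.

Lemma cnorm_eq0 x : (cnorm x == 0) = (x == 0).
Proof. exact: (@normr_eq0 _ (realified A)). Qed.

Lemma cnorm_le_eq0 x : (forall e, 0 < e -> cnorm x <= e) -> x = 0.
Proof.
move=> xe; apply/eqP; rewrite -cnorm_eq0 eq_le cnorm_ge0 andbT.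
by apply/ler_addgt0Pr => e e0; rewrite add0r xe.
Qed.

Lemma star1 : star (1 : A) = 1.
Proof. by rewrite -[LHS]mul1r -[X in X * _](starK (1 : A)) -starM mul1r starK. Qed.

Lemma cnorm1 : cnorm (1 : A) = 1.
Proof.
have /eqP := cnorm_starM (1 : A); rewrite star1 mulr1 expr2 -subr_eq0.
(* The ring is nontrivial, so |1| is nonzero and cancels in |1|^2 = |1|. *)
rewrite -{1}[cnorm _]mulr1 -mulrBr mulf_eq0 cnorm_eq0 oner_eq0 /= subr_eq0.
by move=> /eqP <-.
Qed.

Lemma star0 : star (0 : A) = 0.
Proof. by apply: (addrI (star 0)); rewrite -starD !addr0. Qed.

Lemma starN x : star (- x) = - star x.
Proof. by apply: (addrI (star x)); rewrite -starD !subrr star0. Qed.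

Lemma starB x y : star (x - y) = star x - star y.
Proof. by rewrite starD starN. Qed.

Lemma conjC_real t : (t%:C : R[i])^*%R = t%:C.
Proof. by apply: conj_Creal; rewrite complex_real. Qed.

Lemma starZr t x : star (t%:C *: x) = t%:C *: star x.
Proof. by rewrite starZ conjC_real. Qed.

Lemma cnorm_star x : cnorm (star x) = cnorm x.
Proof.
have le_star y : cnorm y <= cnorm (star y).
  have [->|y0] := eqVneq y 0; first by rewrite star0.
  rewrite -(@ler_pM2r _ (cnorm y)); last by rewrite lt_def cnorm_ge0 cnorm_eq0 y0.
  by rewrite -expr2 -cnorm_starM cnormM.
by apply/eqP; rewrite eq_le le_star -{2}(starK x) le_star.
Qed.

Lemma star_unit x : (star x \is a GRing.unit) = (x \is a GRing.unit).
Proof.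
have H y : y \is a GRing.unit -> star y \is a GRing.unit.
  by move=> yu; apply/unitrP; exists (star y^-1); rewrite -!starM divrr ?mulVr ?star1.
by apply/idP/idP => /H //; rewrite starK.
Qed.

Lemma starV x : star x^-1 = (star x)^-1.
Proof.
have [xu|xn] := boolP (x \is a GRing.unit).
  apply: (@mulrI _ (star x)); first by rewrite star_unit.
  by rewrite -starM mulVr ?divrr ?star1 ?star_unit.
by rewrite !invr_out ?star_unit.
Qed.

(** Majorant test: s is nondecreasing because its increments dominate norms, and it is bounded, so
    its increments over long ranges become small and u is Cauchy. *)
Lemma cnorm_dominated_cvg (u : nat -> A) (s : nat -> R) (M : R) :
  (forall n, cnorm (u n.+1 - u n) <= s n.+1 - s n) -> (forall n, s n <= M) ->
  exists l, forall e, 0 < e -> exists N, forall n, (N <= n)%N ->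
    cnorm (u n - l) < e.
Proof.
move=> us sM.
have s1 n : s n <= s n.+1 by rewrite -subr_ge0 (le_trans _ (us n))// cnorm_ge0.
have smono : {homo s : n m / (n <= m)%N >-> n <= m} by apply/nondecreasing_seqP.
have umn m k : cnorm (u (m + k)%N - u m) <= s (m + k)%N - s m.
  elim: k => [|k IH]; first by rewrite addn0 !subrr cnorm0.
  rewrite addnS -[u _.+1](subrK (u (m + k)%N)) -addrA.
  rewrite (le_trans (cnormD _ _))//.
  by rewrite -[s _.+1](subrK (s (m + k)%N)) -addrA lerD.
have hs : has_sup (range s).
  by split; [exists (s 0%N), 0%N|exists M => _ [n _ <-]].
have sle n : s n <= sup (range s) by apply: sup_upper_bound => //; exists n.
apply: cnorm_complete => e e0.
have [_ [N _ <-] sN] := sup_adherent (divr_gt0 e0 (ltr0n R 2)) hs.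
have uN m : (N <= m)%N -> cnorm (u m - u N) < e / 2.
  move=> Nm; rewrite -(subnKC Nm) (le_lt_trans (umn _ _))//.
  by move: (sle (N + (m - N))%N) sN; lra.
exists N => m n Nm Nn; rewrite -[u m](subrK (u N)) -addrA.
rewrite (le_lt_trans (cnormD _ _))// [e]splitr ltrD ?uN//.
by rewrite cdistC uN.
Qed.

(** Neumann series for I - T, summed by iterating u := y + T u under a scalar majorant. T is only
    assumed additive, so that left and right multiplications and the Sylvester operator are all
    covered. *)
Lemma contraction_solve (T : A -> A) (q : R) y : 0 <= q -> q < 1 ->
  {morph T : u v / u - v} -> (forall u, cnorm (T u) <= q * cnorm u) ->
  exists x, x - T x = y.
Proof.
move=> q0 q1 TB Tq.
pose u := fix u n := if n is n'.+1 then y + T (u n') else 0 : A.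
pose s := fix s n := if n is n'.+1 then cnorm y + q * s n' else 0 : R.
have sM n : s n <= cnorm y / (1 - q).
  elim: n => [|n IH] /=; first by rewrite divr_ge0 ?cnorm_ge0// subr_ge0 ltW.
  rewrite -[leRHS](subrK (q * (cnorm y / (1 - q)))) lerD ?ler_wpM2l//.
  rewrite [leRHS](_ : _ = cnorm y)//; field.
  by rewrite subr_eq0 gt_eqF.
have T0 : T 0 = 0 by rewrite -[X in T X](subrr 0) TB subrr.
have us n : cnorm (u n.+1 - u n) <= s n.+1 - s n.
  elim: n => [|n IH]; first by rewrite /= T0 mulr0 !addr0 !subr0.
  rewrite [u n.+2]/= [X in _ - X]/= opprD addrACA subrr add0r -TB.
  rewrite (le_trans (Tq _))// [s n.+2]/= [X in _ <= _ - X]/= opprD addrACA subrr.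
  by rewrite add0r -mulrBr ler_wpM2l.
have [l ul] := cnorm_dominated_cvg us sM; exists l.
apply/eqP; rewrite -subr_eq0; apply/eqP/cnorm_le_eq0 => e e0.
have [N uN] := ul _ (divr_gt0 e0 (ltr0n R 2)).
have -> : l - T l - y = (l - u N.+1) + T (u N - l).
  by rewrite TB /=; nring.
rewrite (le_trans (cnormD _ _))// [e]splitr lerD//.
  by rewrite cdistC ltW// uN// leqW.
rewrite (le_trans (Tq _))// (le_trans (ler_piMl (cnorm_ge0 _) (ltW q1)))//.
by rewrite ltW// uN.
Qed.

Lemma unit_1sub u : cnorm u < 1 -> 1 - u \is a GRing.unit.
Proof.
move=> u1.
have [|x|x xE] := @contraction_solve (fun x => u * x) (cnorm u) 1 (cnorm_ge0 _) u1.
- by move=> x y; rewrite mulrBr.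
- by rewrite cnormM.
have [|y|y yE] := @contraction_solve (fun x => x * u) (cnorm u) 1 (cnorm_ge0 _) u1.
- by move=> z y; rewrite mulrBl.
- by rewrite [leRHS]mulrC cnormM.
have ux : (1 - u) * x = 1 by rewrite mulrBl mul1r.
have yu : y * (1 - u) = 1 by rewrite mulrBr mulr1.
apply/unitrP; exists x; split => //.
suff -> : x = y by [].
by rewrite -[LHS]mul1r -[X in X * x]yu -mulrA ux mulr1.
Qed.

Lemma unitZ c x : c != 0 -> (c *: x \is a GRing.unit) = (x \is a GRing.unit).
Proof.
move=> c0; apply: scaler_unit; by rewrite unitfE.
Qed.

Lemma unit_sub_scalar c x : cnorm x < complex.Re `|c| -> c%:A - x \is a GRing.unit.
Proof.
move=> xc.
have c0 : c != 0.
  by apply: contraTneq xc => ->; rewrite normr0 /= -leNgt cnorm_ge0.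
have -> : c%:A - x = c *: (1 - c^-1 *: x) by rewrite scalerBr scalerA divff// scale1r.
rewrite unitZ// unit_1sub// cnormZ.
have -> : complex.Re `|c^-1| = (complex.Re `|c|)^-1.
  have cR : `|c| \is Num.real by [].
  have : complex.Re `|c| != 0 by rewrite gt_eqF// (le_lt_trans (cnorm_ge0 x)).
  move: cR => /RRe_real; rewrite normfV; move: (complex.Re `|c|) => r <- r0.
  by rewrite -fmorphV.
by rewrite mulrC ltr_pdivrMr ?mul1r// (le_lt_trans (cnorm_ge0 x)).
Qed.

(* If p + iq is in the spectrum of a, then p + i(q + s) is in that of a + is, so
   p^2 + (q + s)^2 <= |a + is|^2 <= |a|^2 + s^2 for all real s, which forces q = 0. *)
Lemma unit_sa_sub_nonreal a c : star a = a -> complex.Im c != 0 ->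
  a - c%:A \is a GRing.unit.
Proof.
move=> sa c0; case: c c0 => p q /= q0; apply: contraT => au.
have key s : p ^+ 2 + (q + s) ^+ 2 <= cnorm a ^+ 2 + s ^+ 2.
  pose b := a + (0 +i* s)%C%:A.
  have bE : b - (p +i* (q + s))%C%:A = a - (p +i* q)%C%:A.
    rewrite /b -!addrA -!scaleNr -scalerDl; congr (_ + _ *: _).
    by apply/eqP; rewrite eq_complex /=; apply/andP; split; apply/eqP; ring.
  have sb : star b * b = a * a + (s ^+ 2)%:C%:A.
    have -> : star b = a - (0 +i* s)%C%:A.
      rewrite /b starD sa starZ star1; congr (_ + _); rewrite -scaleNr; congr (_ *: _).
      by rewrite -[LHS]/(conjc _) /=; apply/eqP; rewrite eq_complex /= oppr0 !eqxx.
    rewrite /b mulrDr !mulrBl -!scalerAl -!scalerAr !mul1r !mulr1 scalerA.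
    rewrite addrA subrK -scaleNr; congr (_ + _ *: _).
    by apply/eqP; rewrite eq_complex /=; apply/andP; split; apply/eqP; ring.
  have : cnorm b ^+ 2 <= cnorm a ^+ 2 + s ^+ 2.
    rewrite -cnorm_starM sb (le_trans (cnormD _ _))// cnormZr cnorm1 mulr1.
    by rewrite ger0_norm ?sqr_ge0// lerD2r expr2 cnormM.
  apply: le_trans; rewrite leNgt; apply: contra au => bn; rewrite -bE -opprB unitrN.
  apply: unit_sub_scalar; rewrite normc_def /=.
  by rewrite -(ger0_norm (cnorm_ge0 b)) -sqrtr_sqr ltr_sqrt// (le_lt_trans _ bn)// sqr_ge0.
(* This s makes the cross term 2 q s equal to |a|^2 + 1, which contradicts [key]. *)
have := key ((cnorm a ^+ 2 + 1) / (2 * q)).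
have -> : p ^+ 2 + (q + (cnorm a ^+ 2 + 1) / (2 * q)) ^+ 2 =
  p ^+ 2 + q ^+ 2 + (cnorm a ^+ 2 + 1) + ((cnorm a ^+ 2 + 1) / (2 * q)) ^+ 2 by field.
rewrite lerD2r => ?; have := sqr_ge0 p; have := sqr_ge0 q; lra.
Qed.

End CStarBasics.

(** * Spectral radius of self-adjoint elements *)

Section SpectralRadius.
Context (R : realType) (A : cstarAlgType R).
Implicit Types (x y a b u w : A) (t : R) (c z : R[i]).

Lemma Re_norm_ge0 z : 0 <= complex.Re `|z|.
Proof. by rewrite normc_def sqrtr_ge0. Qed.

Lemma Re_normM z z' : complex.Re `|z * z'| = complex.Re `|z| * complex.Re `|z'|.
Proof. by rewrite normrM !normc_def /= mul0r subr0. Qed.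

Lemma Re_norm_real t : complex.Re `|t%:C| = `|t|.
Proof. by rewrite normc_def /= expr0n addr0 sqrtr_sqr. Qed.

Lemma subrVV a b : a \is a GRing.unit -> b \is a GRing.unit ->
  a^-1 - b^-1 = a^-1 * (b - a) * b^-1.
Proof. by move=> au bu; rewrite mulrBr mulVr// mulrBl mul1r mulrK. Qed.

(** The inverse g of a - w satisfies g = a^-1 + g w a^-1, and |w a^-1| <= 1/2 lets half of |g| be
    absorbed. *)
Lemma cnormV_perturb a w : a \is a GRing.unit -> cnorm w * cnorm a^-1 <= 2^-1 ->
  a - w \is a GRing.unit /\ cnorm (a - w)^-1 <= 2 * cnorm a^-1.
Proof.
move=> au wa.
have wa1 : cnorm (w * a^-1) <= 2^-1 by rewrite (le_trans (cnormM _ _)).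
have awE : a - w = (1 - w * a^-1) * a by rewrite mulrBl mul1r mulrVK.
have awu : a - w \is a GRing.unit.
  by rewrite awE unitrMl// unit_1sub// (le_lt_trans wa1)// invf_lt1 ?ltr1n.
split=> //.
have gE : (a - w)^-1 = a^-1 + (a - w)^-1 * (w * a^-1).
  apply: (mulrI awu); rewrite mulrDr mulrA divrr// mul1r mulrBl divrr//.
  by rewrite subrK.
have := cnormD a^-1 ((a - w)^-1 * (w * a^-1)); rewrite -gE.
have := cnormM (a - w)^-1 (w * a^-1).
have : cnorm (a - w)^-1 * cnorm (w * a^-1) <= cnorm (a - w)^-1 * 2^-1.
  by rewrite ler_wpM2l// cnorm_ge0.
lra.
Qed.

(** The hypothesis covers real z. For the others 1 - z x = - z (x - z^-1), where z^-1 is again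
    nonreal and x is self-adjoint. *)
Lemma sa_unit_1subZ x z : star x = x ->
  (forall t, `|t| <= 1 -> 1 - t%:C *: x \is a GRing.unit) ->
  `|complex.Re z| <= 1 -> 1 - z *: x \is a GRing.unit.
Proof.
move=> sx xu; case: z => p q /= p1.
have [->|q0] := eqVneq q 0; first exact: xu.
have z0 : (p +i* q)%C != 0 by rewrite eq_complex /= (negbTE q0) andbF.
have -> : 1 - (p +i* q)%C *: x =
    (- (p +i* q)%C) *: (x - ((p +i* q)%C^-1)%:A).
  by rewrite scaleNr scalerBr opprB scalerA divff// scale1r.
rewrite unitZ ?oppr_eq0//; apply: unit_sa_sub_nonreal => //.
apply: contra q0 => /eqP zi; rewrite -(complex_real p) -realV.
by case: (_^-1) zi => r s /= ->; rewrite complex_real.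
Qed.

(** Compactness is used on a square, a product of segments, which contains the closed unit disc. The
    bound M is a second variable tending to infinity, so that local bounds combine into a uniform
    one. *)
Lemma resolvent_bounded x : star x = x ->
  (forall t, `|t| <= 1 -> 1 - t%:C *: x \is a GRing.unit) ->
  exists M, forall p q : R, `|p| <= 1 -> `|q| <= 1 ->
    cnorm (1 - (p +i* q)%C *: x)^-1 <= M.
Proof.
move=> sx xu.
have cpt : compact (`[(-1)%R, 1%R]%classic `*` `[(-1)%R, 1%R]%classic : set (R * R)).
  by apply: compact_setX; apply: segment_compact.
pose P (M : R) (pq : R * R) := cnorm (1 - (pq.1 +i* pq.2)%C *: x)^-1 <= M.
have := (compact_near_coveringP _).1 cpt R (pinfty_nbhs R) P _.
case=> [[p0 q0] /= []|M [Mr Mb]]; last first.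
  exists (M + 1) => p q p1 q1; apply: (Mb (M + 1) _ (p, q)); first by rewrite ltrDl.
  by split; rewrite /= in_itv /= -ler_norml.
rewrite !in_itv /= -!ler_norml => p01 q01.
set g := (1 - (p0 +i* q0)%C *: x)^-1.
have gu : 1 - (p0 +i* q0)%C *: x \is a GRing.unit by apply: sa_unit_1subZ.
(* For |p - p0|, |q - q0| < d the perturbation has norm at most 2 d |x|, and the factor 4 brings 2 d
   |x| |g| below 1/2. *)
pose d := (4 * (cnorm x * cnorm g + 1))^-1.
have xg0 : 0 <= cnorm x * cnorm g by rewrite mulr_ge0// cnorm_ge0.
have d0 : 0 < d by rewrite invr_gt0 mulr_gt0// ltr_wpDl.
exists (ball (p0, q0) d, [set M | 2 * cnorm g < M]).
  split; first exact: nbhsx_ballx.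
  by exists (2 * cnorm g); split => //; rewrite num_real.
move=> [[p q] M] /= [[pd qd] gM].
rewrite /P /= (le_trans _ (ltW gM))//.
have -> : 1 - (p +i* q)%C *: x =
   1 - (p0 +i* q0)%C *: x - ((p - p0) +i* (q - q0))%C *: x.
  rewrite -addrA -opprD -scalerDl; congr (1 - _ *: _).
  by apply/eqP; rewrite eq_complex /= ![_ + (_ - _)]addrC !subrK !eqxx.
apply: (cnormV_perturb gu _).2; rewrite -/g.
have -> : ((p - p0) +i* (q - q0))%C = (p - p0)%:C + 'i * (q - q0)%:C :> R[i].
  rewrite -complexiE.
  by apply/eqP; rewrite eq_complex /=; apply/andP; split; apply/eqP; ring.
rewrite scalerDl -scalerA.
have h1 : cnorm ((p - p0)%:C *: x + 'i *: ((q - q0)%:C *: x)) <= 2 * d * cnorm x.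
  rewrite (le_trans (cnormD _ _))// cnormZi !cnormZr -mulrDl.
  rewrite ler_wpM2r ?cnorm_ge0// mulr2n mulrDl mul1r lerD// distrC ltW//.
rewrite (le_trans (ler_wpM2r (cnorm_ge0 _) h1))//.
have d1 : d * (cnorm x * cnorm g + 1) = 4^-1.
  rewrite /d invfM -mulrA mulVf ?mulr1// gt_eqF// ltr_wpDl//.
have := ltW d0; nra.
Qed.

(** The comparison of z with g z is the form of uniform continuity that survives squaring: g is
    replaced by g^2 while eps stays the same. *)
Lemma resolvent_dilation x eps : star x = x -> 0 < eps ->
  (forall t, `|t| <= 1 -> 1 - t%:C *: x \is a GRing.unit) ->
  exists g : R, [/\ 0 <= g, g < 1 & forall z, complex.Re `|z| <= 1 ->
    1 - z *: x \is a GRing.unit /\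
    cnorm ((1 - z *: x)^-1 - (1 - (g%:C * z) *: x)^-1) <= eps].
Proof.
move=> sx e0 xu.
have [M0 M0b] := resolvent_bounded sx xu.
pose M := `|M0|.
have Mb p q : `|p| <= 1 -> `|q| <= 1 -> cnorm (1 - (p +i* q)%C *: x)^-1 <= M.
  by move=> p1 q1; rewrite (le_trans (M0b _ _ p1 q1))// ler_norm.
(* The resolvents differ by at most M^2 h |x|, which this h keeps below eps. *)
pose h := Num.min (2^-1) (eps / (M ^+ 2 * cnorm x + 1)).
have D0 : 0 < M ^+ 2 * cnorm x + 1.
  by rewrite ltr_wpDl// mulr_ge0 ?sqr_ge0// cnorm_ge0.
have h0 : 0 < h by rewrite lt_min invr_gt0 ltr0n divr_gt0.
have h2 : h <= 2^-1 by rewrite ge_min lexx.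
have hD : h * (M ^+ 2 * cnorm x + 1) <= eps.
  by rewrite -ler_pdivlMr// ge_min lexx orbT.
exists (1 - h); split; [lra|lra|] => z z1.
have pq z' : complex.Re `|z'| <= 1 -> `|complex.Re z'| <= 1 /\ `|complex.Im z'| <= 1.
  rewrite normc_def /= => zz1.
  have p2 := sqr_ge0 (complex.Re z'); have q2 := sqr_ge0 (complex.Im z').
  by split; rewrite (le_trans _ zz1)// -sqrtr_sqr ler_wsqrtr// ?lerDl ?lerDr.
have z'1 : complex.Re `|(1 - h)%:C * z| <= 1.
  rewrite Re_normM Re_norm_real ger0_norm; last lra.
  by rewrite mulr_ile1 ?Re_norm_ge0//; lra.
have [zr zi] := pq _ z1; have [z'r z'i] := pq _ z'1.
have zu : 1 - z *: x \is a GRing.unit by exact: sa_unit_1subZ.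
have z'u : 1 - ((1 - h)%:C * z) *: x \is a GRing.unit by exact: sa_unit_1subZ.
split=> //.
have zM : cnorm (1 - z *: x)^-1 <= M by case: {z1 z'1 zu z'u z'r z'i} z zr zi => p q; exact: Mb.
have z'M : cnorm (1 - ((1 - h)%:C * z) *: x)^-1 <= M.
  by case: {z1 z'1 zu z'u zr zi zM} (_ * z) z'r z'i => p q; exact: Mb.
have -> : (1 - z *: x)^-1 - (1 - ((1 - h)%:C * z) *: x)^-1 =
   (1 - z *: x)^-1 * ((h%:C * z) *: x) * (1 - ((1 - h)%:C * z) *: x)^-1.
  rewrite subrVV//; congr (_ * _ * _).
  rewrite [LHS](_ : _ = z *: x - ((1 - h)%:C * z) *: x); last nring.
  by rewrite -scalerBl rmorphB rmorph1 /=; congr (_ *: _); ring.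
rewrite (le_trans (cnormM _ _))// (le_trans (ler_wpM2r (cnorm_ge0 _) (cnormM _ _)))//.
have hz : cnorm ((h%:C * z) *: x) <= h * cnorm x.
  rewrite -scalerA cnormZr gtr0_norm//; apply: ler_wpM2l; first exact: ltW.
  by rewrite cnormZ ler_piMl ?cnorm_ge0.
rewrite (le_trans _ hD)//.
have M0' : 0 <= M by rewrite normr_ge0.
rewrite (@le_trans _ _ (M * (h * cnorm x) * M))//.
  by rewrite ler_pM// ?mulr_ge0 ?cnorm_ge0// ler_pM ?cnorm_ge0.
have := ltW h0; nra.
Qed.

(* Averaging over z and -z turns the resolvent of y into that of y^2. *)
Lemma resolvent_dilation_sqr y (g eps : R) :
  (forall z, complex.Re `|z| <= 1 -> 1 - z *: y \is a GRing.unit /\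
    cnorm ((1 - z *: y)^-1 - (1 - (g%:C * z) *: y)^-1) <= eps) ->
  0 <= g -> g <= 1 ->
  forall z, complex.Re `|z| <= 1 -> 1 - z *: (y * y) \is a GRing.unit /\
    cnorm ((1 - z *: (y * y))^-1 - (1 - ((g ^+ 2)%:C * z) *: (y * y))^-1) <= eps.
Proof.
move=> H g0 g1 z z1.
pose w := sqrtC z.
have w2 : z = w * w by rewrite -expr2 sqrtCK.
have NN (v : R[i]) : complex.Re `|- v| = complex.Re `|v| by rewrite normrN.
have w1 : complex.Re `|w| <= 1.
  by move: z1; rewrite w2 Re_normM -expr2 -[leRHS](expr1n _ 2) ler_pXn2r ?nnegrE ?Re_norm_ge0.
have gw1 : complex.Re `|g%:C * w| <= 1.
  by rewrite Re_normM Re_norm_real mulr_ile1 ?normr_ge0 ?Re_norm_ge0// ger0_norm.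
have fact (v : R[i]) : 1 - (v * v) *: (y * y) = (1 - v *: y) * (1 - (- v) *: y).
  rewrite scaleNr opprK mulrDr mulr1 mulrBl mul1r -scalerAl -scalerAr scalerA.
  by rewrite addrA subrK.
have mean (v : R[i]) : 1 - v *: y \is a GRing.unit -> 1 - (- v) *: y \is a GRing.unit ->
  (1 - (v * v) *: (y * y))^-1 =
   (2^-1 : R)%:C *: ((1 - v *: y)^-1 + (1 - (- v) *: y)^-1).
  move=> vu nvu; rewrite fact invrM//.
  have two : (1 - (- v) *: y) + (1 - v *: y) = (2 : R)%:C *: 1.
    rewrite scaleNr opprK addrC addrACA addNr addr0.
    by rewrite -[RHS]/((2%:R : R)%:C *: 1) rmorph_nat scaler_nat.
  have -> : (1 - v *: y)^-1 + (1 - (- v) *: y)^-1 =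
     (1 - (- v) *: y)^-1 * ((1 - (- v) *: y) + (1 - v *: y)) * (1 - v *: y)^-1.
    by rewrite mulrDr mulVr// mulrDl mul1r mulrK.
  rewrite two -scalerAr mulr1 -scalerAl scalerA -rmorphM mulVf ?pnatr_eq0//.
  by rewrite rmorph1 scale1r.
have [wu wd] := H _ w1; have [|nwu nwd] := H (- w); first by rewrite NN.
have [gwu _] := H _ gw1; have [|ngwu _] := H (- (g%:C * w)); first by rewrite NN.
have -> : (g ^+ 2)%:C * z = (g%:C * w) * (g%:C * w).
  by rewrite w2 expr2 rmorphM mulrACA.
rewrite w2; split; first by rewrite fact unitrMl.
rewrite !mean// -scalerBr cnormZr ger0_norm ?invr_ge0 ?ler0n//.
rewrite opprD addrACA.
have := cnormD ((1 - w *: y)^-1 - (1 - (g%:C * w) *: y)^-1)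
  ((1 - (- w) *: y)^-1 - (1 - (- (g%:C * w)) *: y)^-1).
by move: nwd wd; rewrite mulrN; lra.
Qed.

Lemma cnorm_sa_sqr x : star x = x -> cnorm (x * x) = cnorm x ^+ 2.
Proof. by move=> sx; rewrite -{1}sx cnorm_starM. Qed.

Lemma sa_cnorm_neq1 x : star x = x -> cnorm x = 1 ->
  (forall t, `|t| <= 1 -> 1 - t%:C *: x \is a GRing.unit) -> False.
Proof.
move=> sx x1 xu.
(* With 1/8 here and d <= 1/9 below, |h - 1| <= 1/4; then v = (h - 1) - v (h - 1) has norm at most
   1/2, against |v| = 1. *)
have e8 : 0 < (8^-1 : R) by rewrite invr_gt0 ltr0n.
have [g [g0 g1 gx]] := resolvent_dilation sx e8 xu.
pose v k := iter k (fun y : A => y * y) x.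
have vP k : star (v k) = v k /\ cnorm (v k) = 1.
  elim: k => [//|k [sk nk]]; rewrite /v iterS -/(v k) starM sk; split=> //.
  by rewrite cnorm_sa_sqr// nk expr1n.
have vd k : forall z, complex.Re `|z| <= 1 -> 1 - z *: v k \is a GRing.unit /\
    cnorm ((1 - z *: v k)^-1 - (1 - ((g ^+ (2 ^ k))%:C * z) *: v k)^-1) <= 8^-1.
  elim: k => [|k IH]; first by rewrite expn0 expr1.
  rewrite expnSr exprM; apply: resolvent_dilation_sqr => //.
    by rewrite exprn_ge0.
  by rewrite exprn_ile1// ltW.
have [N gN] : exists N, g ^+ N < 9^-1.
  have /cvgrPdist_lt gc : (fun n => g ^+ n) @ \oo --> (0 : R).
    by apply: cvg_expr; rewrite ger0_norm.
  have [|N _ Nb] := gc 9^-1; first by rewrite invr_gt0 ltr0n.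
  exists N; have := Nb N (leqnn N).
  by rewrite /= sub0r normrN ger0_norm// exprn_ge0.
have [sv nv] := vP N; have := vd N 1.
rewrite normr1 => /(_ (lexx _))[]; rewrite !scale1r mulr1 => vu.
set d := g ^+ (2 ^ N).
(* The same N serves as exponent and as number of squarings: 2^N >= N gives d <= g^N. *)
have d0 : 0 <= d by rewrite exprn_ge0.
have d9 : d <= 9^-1.
  apply: le_trans (ltW gN); apply: ler_wiXn2l => //; first exact: ltW.
  exact/ltnW/ltn_expl.
have [] := @cnormV_perturb 1 (d%:C *: v N) (unitr1 _).
  by rewrite invr1 cnorm1 mulr1 cnormZr nv mulr1 ger0_norm//; lra.
rewrite invr1 cnorm1 mulr1; set f := (1 - _%:C *: _)^-1 => fu f2.
set h := (1 - v N)^-1.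
have f1 : cnorm (f - 1) <= d * cnorm f.
  have -> : f - 1 = d%:C *: (v N * f).
    have E : f - (d%:C *: v N) * f = 1 by rewrite -{1}[f]mul1r -mulrBl divrr.
    by rewrite scalerAl -E opprB addrC subrK.
  rewrite cnormZr ger0_norm// ler_wpM2l// (le_trans (cnormM _ _))//.
  by rewrite nv mul1r.
have f4 : cnorm f <= 9 / 8.
  have := cnormD (f - 1) 1; rewrite subrK cnorm1; have := cnorm_ge0 f; nra.
move=> hf.
have h1 : cnorm (h - 1) <= 4^-1.
  rewrite -[h](subrK f) -addrA (le_trans (cnormD _ _))//.
  have := cnorm_ge0 f; nra.
have vE : v N = (h - 1) - v N * (h - 1).
  have E : h - v N * h = 1 by rewrite -{1}[h]mul1r -mulrBl divrr.
  by rewrite mulrBr mulr1 -E; nring.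
have := cnormB (h - 1) (v N * (h - 1)); rewrite -vE nv.
have := cnormM (v N) (h - 1); rewrite nv; lra.
Qed.

(** If |x| >= 1, then x / |x| inherits the hypothesis, because t / |x| stays in [-1, 1], and it has
    norm 1. *)
Theorem sa_cnorm_lt1 x : star x = x ->
  (forall t, `|t| <= 1 -> 1 - t%:C *: x \is a GRing.unit) -> cnorm x < 1.
Proof.
move=> sx xu; rewrite ltNge; apply/negP => x1.
have x0 : 0 < cnorm x by rewrite (lt_le_trans _ x1).
apply: (@sa_cnorm_neq1 ((cnorm x)^-1%:C *: x)).
- by rewrite starZr sx.
- by rewrite cnormZr ger0_norm ?invr_ge0 ?cnorm_ge0// mulVf// gt_eqF.
- move=> t t1; rewrite scalerA -rmorphM; apply: xu.
  rewrite normrM mulr_ile1// ger0_norm ?invr_ge0 ?cnorm_ge0//.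
  by rewrite invf_le1.
Qed.

End SpectralRadius.

(** * Positive elements *)

Section Positivity.
Context (R : realType) (A : cstarAlgType R).
Implicit Types (x y a b u w m : A) (t : R) (c z : R[i]).

Lemma sa_scalar t : star (t%:C%:A : A) = t%:C%:A.
Proof. by rewrite starZr star1. Qed.

Lemma cnorm_scalar t : cnorm (t%:C%:A : A) = `|t|.
Proof. by rewrite cnormZr cnorm1 mulr1. Qed.

(** With T = t + e, a failure of 1 - s (t - a) / T to be invertible would put t - T / s in the
    spectrum of a. This number is negative for 0 < s <= 1 and exceeds |a| for s < 0. *)
Lemma cnormB_positive a t : positive a -> cnorm a <= t ->
  cnorm (t%:C%:A - a) <= t.
Proof.
move=> [sa pa] at_; have t0 : 0 <= t by rewrite (le_trans (cnorm_ge0 a)).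
apply/ler_addgt0Pr => e e0; have T0 : 0 < t + e by lra.
suff : cnorm ((t + e)^-1%:C *: (t%:C%:A - a)) < 1.
  rewrite cnormZr ger0_norm; last by rewrite invr_ge0 ltW.
  by rewrite mulrC ltr_pdivrMr// mul1r => /ltW.
apply: sa_cnorm_lt1; first by rewrite starZr starB sa sa_scalar.
move=> s; have [->|s0] := eqVneq s 0; first by rewrite scale0r subr0 unitr1.
rewrite ler_norml => /andP[s1 s2].
have -> : 1 - s%:C *: ((t + e)^-1%:C *: (t%:C%:A - a)) =
   (s / (t + e))%:C *: (a - (t - (t + e) / s)%:C%:A).
  rewrite scalerA -rmorphM !scalerBr !scalerA -!rmorphM.
  have -> : s / (t + e) * (t - (t + e) / s) = s / (t + e) * t - 1.
    by field; rewrite s0 gt_eqF.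
  rewrite rmorphB rmorph1 scalerBl scale1r; nring.
rewrite unitZ; last first.
  by rewrite (inj_eq (@complexI _)) mulf_neq0 ?invr_eq0// gt_eqF.
move: s0; rewrite neq_lt => /orP[sn|sp].
  rewrite -opprB unitrN unit_sub_scalar// Re_norm_real.
  rewrite (le_lt_trans at_)// (lt_le_trans _ (ler_norm _))//.
  by rewrite ltrDl -mulrN -invrN divr_gt0// oppr_gt0.
apply: contraT => /pa; rewrite lecR leNgt subr_lt0 ltr_pdivlMr//; nra.
Qed.

(** A negative spectral value p would be at distance t - p > t from t, outside the disc that
    contains the spectrum of t - a. *)
Lemma positive_cnormB a t : star a = a -> cnorm (t%:C%:A - a) <= t -> positive a.
Proof.
move=> sa at_; split=> // c ca.
have [ci|/(unit_sa_sub_nonreal sa)] := eqVneq (complex.Im c) 0; last first.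
  by move=> au; move: ca; rewrite /spectrum /= au.
case: c ci ca => p q /= -> ca; rewrite lecR leNgt; apply/negP => p0.
move: ca; apply/negP; rewrite negbK.
have -> : a - p%:C%:A = (t - p)%:C%:A - (t%:C%:A - a).
  by rewrite rmorphB scalerBl; nring.
apply: unit_sub_scalar; rewrite Re_norm_real (le_lt_trans at_)//.
by rewrite (lt_le_trans _ (ler_norm _))//; lra.
Qed.

(** The norm criterion is additive in a and t simultaneously. *)
Lemma positiveD a b : positive a -> positive b -> positive (a + b).
Proof.
move=> pa pb.
apply: (@positive_cnormB _ (cnorm a + cnorm b)); first by rewrite starD pa.1 pb.1.
have -> : (cnorm a + cnorm b)%:C%:A - (a + b) =
    ((cnorm a)%:C%:A - a) + ((cnorm b)%:C%:A - b).
  by rewrite rmorphD scalerDl; nring.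
by rewrite (le_trans (cnormD _ _))// lerD// cnormB_positive.
Qed.

Lemma positiveZ a t : 0 <= t -> positive a -> positive (t%:C *: a).
Proof.
move=> t0 pa; apply: (@positive_cnormB _ (t * cnorm a)).
  by rewrite starZr pa.1.
rewrite rmorphM -scalerA -scalerBr cnormZr ger0_norm// ler_wpM2l//.
exact: cnormB_positive.
Qed.

Lemma positive_cnorm_sub a : star a = a -> positive ((cnorm a)%:C%:A - a).
Proof.
move=> sa; apply: (@positive_cnormB _ (cnorm a)).
  by rewrite starB sa sa_scalar.
by rewrite opprB addrC subrK.
Qed.

Lemma positive_unitD a t : 0 < t -> positive a -> a + t%:C%:A \is a GRing.unit.
Proof.
move=> t0 [sa pa]; apply: contraT.
have -> : a + t%:C%:A = a - (- t)%:C%:A by rewrite rmorphN scaleNr opprK.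
by move=> /pa; rewrite lecR oppr_ge0 leNgt t0.
Qed.

(** If c = w^2 is not a nonnegative real, w is not real and both factors of (a - w)(a + w) are
    invertible. *)
Lemma positive_sqr a : star a = a -> positive (a * a).
Proof.
move=> sa; split; first by rewrite starM sa.
move=> c ca; pose w := sqrtC c.
have [wi|wi] := eqVneq (complex.Im w) 0.
  rewrite -[c]sqrtCK -/w; case: w wi => p q /= ->.
  by rewrite -[(p +i* 0)%C]/(p%:C) expr2 -rmorphM lecR -expr2 sqr_ge0.
have wi' : complex.Im (- w) != 0 by case: w wi => p q /=; rewrite oppr_eq0.
move: ca; rewrite /spectrum /= -[c]sqrtCK -/w.
have -> : a * a - (w ^+ 2)%:A = (a - w%:A) * (a - (- w)%:A).
  rewrite scaleNr opprK mulrDr !mulrBl -!scalerAl -!scalerAr !mul1r !mulr1 scalerA.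
  by rewrite expr2 addrA subrK.
by rewrite unitrMl unit_sa_sub_nonreal.
Qed.

(** The spectrum of a can only contain 0, so the spectral bound gives a / |a| norm less than 1
    unless a = 0. *)
Lemma positive_anti a : positive a -> positive (- a) -> a = 0.
Proof.
move=> [sa pa] [sna pna]; apply: contraTeq isT => a0.
have n0 : 0 < cnorm a by rewrite lt_def cnorm_ge0 cnorm_eq0 a0.
have : cnorm ((cnorm a)^-1%:C *: a) < 1.
  apply: sa_cnorm_lt1; first by rewrite starZr sa.
  move=> s _; have [->|s0] := eqVneq s 0; first by rewrite scale0r subr0 unitr1.
  pose r := cnorm a / s.
  have -> : 1 - s%:C *: ((cnorm a)^-1%:C *: a) = (- r^-1)%:C *: (a - r%:C%:A).
    rewrite scalerBr !scalerA -!rmorphM mulNr mulVf; last first.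
      by rewrite mulf_neq0 ?invr_eq0// gt_eqF.
    rewrite !rmorphN rmorph1 !scaleNr scale1r opprK addrC.
    by rewrite /r invf_div.
  rewrite unitZ; last first.
    by rewrite (inj_eq (@complexI _)) oppr_eq0 invr_eq0 mulf_neq0 ?invr_eq0// gt_eqF.
  move: s0; rewrite neq_lt => /orP[sn|sp].
    apply: contraT => /pa; rewrite lecR leNgt.
    by rewrite -oppr_gt0 -mulrN -invrN divr_gt0// oppr_gt0.
  rewrite -unitrN; apply: contraT.
  have -> : - (a - r%:C%:A) = - a - (- r)%:C%:A by rewrite rmorphN scaleNr opprD.
  by move=> /pna; rewrite lecR oppr_ge0 leNgt divr_gt0.
rewrite cnormZr ger0_norm ?invr_ge0 ?cnorm_ge0// mulVf ?ltxx//.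
by rewrite gt_eqF.
Qed.

(* The iterates of u |-> (w + u^2) / 2 are polynomials in w with nonnegative
   coefficients, so they are dominated by the same iterates at cnorm w. *)
Lemma sqrt_1sub w : cnorm w <= 1 -> exists u,
  [/\ cnorm u <= cnorm w, (1 - u) * (1 - u) = 1 - w,
      star w = w -> star u = u &
      forall y, y * w = w * y -> y * u = u * y].
Proof.
move=> w1; set r := cnorm w; have r0 : 0 <= r by exact: cnorm_ge0.
pose u := fix u n := if n is n'.+1 then (2^-1 : R)%:C *: (w + u n' * u n') else 0 : A.
pose s := fix s n := if n is n'.+1 then 2^-1 * (r + s n' * s n') else 0 : R.
have s0r n : 0 <= s n <= r.
  elim: n => [|n /andP[IH0 IH1]] /=; first by rewrite lexx.
  by move: w1; rewrite -/r => w1; apply/andP; split; nra.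
have un n : cnorm (u n) <= s n.
  elim: n => [|n IH] /=; first by rewrite cnorm0.
  rewrite cnormZr ger0_norm ?invr_ge0 ?ler0n// ler_wpM2l ?invr_ge0 ?ler0n//.
  rewrite (le_trans (cnormD _ _))// lerD2l (le_trans (cnormM _ _))//.
  by rewrite ler_pM ?cnorm_ge0.
have sub_sqr (v v' : A) : v * v - v' * v' = v * (v - v') + (v - v') * v' by nring.
have uS n : u n.+1 = (2^-1 : R)%:C *: (w + u n * u n) by [].
have sS n : s n.+1 = 2^-1 * (r + s n * s n) by [].
have us n : cnorm (u n.+1 - u n) <= s n.+1 - s n.
  elim: n => [|n IH].
    rewrite /= !mulr0 !addr0 !subr0 cnormZr ger0_norm//.
  rewrite uS [X in _ - X]uS -scalerBr cnormZr ger0_norm ?invr_ge0 ?ler0n//.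
  rewrite (sS n.+1) [X in _ <= _ - X](sS n) -mulrBr ler_wpM2l ?invr_ge0 ?ler0n//.
  rewrite [w + _ * _ - _](_ : _ = u n.+1 * u n.+1 - u n * u n); last nring.
  rewrite sub_sqr (le_trans (cnormD _ _))//.
  have h1 := le_trans (cnormM (u n.+1) (u n.+1 - u n)) (ler_pM (cnorm_ge0 _) (cnorm_ge0 _) (un _) IH).
  have h2 := le_trans (cnormM (u n.+1 - u n) (u n)) (ler_pM (cnorm_ge0 _) (cnorm_ge0 _) IH (un _)).
  by rewrite (le_trans (lerD h1 h2))//; lra.
have [|l ul] := cnorm_dominated_cvg (M := r) us; first by move=> n; case/andP: (s0r n).
(* Star-invariance and commutation hold along the iterates and pass to l through this criterion. *)
have lim0 (x : A) (K : R) : (forall n, cnorm x <= K * cnorm (u n - l)) -> x = 0.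
  move=> xK; apply: cnorm_le_eq0 => e e0.
  have K0 : 0 < `|K| + 1 by rewrite ltr_wpDl.
  have [N uN] := ul _ (divr_gt0 e0 K0).
  rewrite (le_trans (xK N))//.
  have := uN N (leqnn N); rewrite ltr_pdivlMr// => h.
  have := cnorm_ge0 (u N - l); have := ler_norm K; nra.
have ur n : cnorm (u n) <= r by rewrite (le_trans (un n))//; case/andP: (s0r n).
have lr : cnorm l <= r.
  apply/ler_addgt0Pr => e e0; have [N uN] := ul _ e0.
  have -> : l = u N - (u N - l) by nring.
  by rewrite (le_trans (cnormB _ _))// lerD// ltW// uN.
have lE : l = (2^-1 : R)%:C *: (w + l * l).
  apply/eqP; rewrite -subr_eq0; apply/eqP/cnorm_le_eq0 => e e0.
  have [N uN] := ul _ (divr_gt0 e0 (ltr0n R 2)).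
  have -> : l - (2^-1 : R)%:C *: (w + l * l) =
     (l - u N.+1) + (2^-1 : R)%:C *: (u N * u N - l * l).
    rewrite uS [u N * u N - _](_ : _ = (w + u N * u N) - (w + l * l)); last nring.
    by rewrite scalerBr; nring.
  rewrite (le_trans (cnormD _ _))// [e]splitr lerD//.
    by rewrite cdistC ltW// uN// leqW.
  rewrite cnormZr ger0_norm ?invr_ge0 ?ler0n// sub_sqr.
  have := uN N (leqnn N); have := ur N; move: w1; rewrite -/r.
  have := cnorm_ge0 (u N - l); have := cnorm_ge0 l; have := cnorm_ge0 (u N).
  have := cnormD (u N * (u N - l)) ((u N - l) * l).
  have := cnormM (u N) (u N - l); have := cnormM (u N - l) l; nra.
exists l; split => //.
- have two : (2 : R)%:C *: l = w + l * l.
    by rewrite {1}lE scalerA -rmorphM divff ?pnatr_eq0// rmorph1 scale1r.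
  have l2 : l + l = w + l * l by rewrite -two rmorph_nat scaler_nat mulr2n.
  have -> : w = l + l - l * l by rewrite l2 addrK.
  by nring.
- move=> sw; apply/eqP; rewrite -subr_eq0; apply/eqP/(lim0 _ 2) => n.
  have sun : star (u n) = u n.
    by elim: n => [|n IH] /=; rewrite ?star0// starZr starD sw starM IH.
  have -> : star l - l = (u n - l) - star (u n - l) by rewrite starB sun; nring.
  by rewrite (le_trans (cnormB _ _))// cnorm_star; lra.
- move=> y yw; apply/eqP; rewrite -subr_eq0; apply/eqP/(lim0 _ (2 * cnorm y)) => n.
  have yun : y * u n = u n * y.
    elim: n => [|n IH] /=; first by rewrite mulr0 mul0r.
    by rewrite -scalerAr -scalerAl mulrDr mulrDl yw mulrA IH -mulrA IH mulrA.
  have -> : y * l - l * y = (u n - l) * y - y * (u n - l).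
    by rewrite mulrBr mulrBl yun; nring.
  rewrite (le_trans (cnormB _ _))//.
  have := cnormM (u n - l) y; have := cnormM y (u n - l); lra.
Qed.

(** Write a = t (1 - w) and take sqrt t (1 - u). The + 1 in t keeps it nonzero when a = 0. The
    commutation clause replaces the statement that the root is a limit of polynomials in a. *)
Lemma positive_sqrt a : positive a -> exists m,
  [/\ positive m, m * m = a & forall y, y * a = a * y -> y * m = m * y].
Proof.
move=> pa; pose t := cnorm a + 1.
have t0 : 0 < t by rewrite ltr_wpDl// cnorm_ge0.
pose w := 1 - (t^-1)%:C *: a.
have tw : t%:C *: w = t%:C%:A - a.
  by rewrite /w scalerBr scalerA -rmorphM divff ?gt_eqF// rmorph1 scale1r.
have w1 : cnorm w <= 1.
  rewrite -(ler_pM2l t0) mulr1 -{1}(gtr0_norm t0) -cnormZr tw.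
  by apply: cnormB_positive => //; rewrite lerDl.
have [u [uw u2 su cu]] := sqrt_1sub w1.
have sw : star w = w by rewrite /w starB star1 starZr pa.1.
exists ((Num.sqrt t)%:C *: (1 - u)); split.
- apply: (@positive_cnormB _ (Num.sqrt t)).
    by rewrite starZr starB star1 su.
  rewrite -scalerBr opprB addrC subrK cnormZr ger0_norm ?sqrtr_ge0//.
  by rewrite ler_piMr ?sqrtr_ge0// (le_trans uw).
- rewrite -scalerAl -scalerAr u2 scalerA -rmorphM -expr2 sqr_sqrtr ?ltW//.
  by rewrite scalerBr tw opprB addrC subrK.
- move=> y ya; rewrite -scalerAl -scalerAr mulrBr mulrBl mul1r mulr1 cu//.
  by rewrite /w mulrBr mulrBl mul1r mulr1 -scalerAl -scalerAr ya.
Qed.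

(** [star y * y] and [y * star y] have the same spectrum away from 0: for c nonzero and d = y^* y +
    c invertible, k = c^-1 (1 - y d^-1 y^* ) inverts y y^* + c. *)
Lemma positive_starM_swap y : positive (- (star y * y)) -> positive (- (y * star y)).
Proof.
move=> [_ py]; split; first by rewrite starN starM starK.
move=> c cy; apply: contraT => c0.
have cn0 : c != 0 by apply: contra c0 => /eqP ->.
have : - (star y * y) - c%:A \is a GRing.unit by apply: contraT => /py; rewrite (negbTE c0).
rewrite -unitrN opprD !opprK => du.
move: cy; rewrite /spectrum /= -unitrN opprD !opprK => /negP[].
set d := star y * y + c%:A in du *.
pose k := c^-1 *: (1 - y * d^-1 * star y).
have yd : y * d = (y * star y + c%:A) * y.
  by rewrite mulrDr mulrDl mulrA -scalerAr -scalerAl mul1r mulr1.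
have dy : d * star y = star y * (y * star y + c%:A).
  by rewrite mulrDr mulrDl mulrA -scalerAr -scalerAl mul1r mulr1.
apply/unitrP; exists k; split.
  rewrite /k -scalerAl mulrBl mul1r -(mulrA _ (star y)) -dy -mulrA mulKr//.
  by rewrite addrAC subrr add0r scalerA mulVf// scale1r.
rewrite /k -scalerAr mulrBr mulr1 !mulrA -yd -(mulrA y) divrr// mulr1.
by rewrite addrAC subrr add0r scalerA mulVf// scale1r.
Qed.

(* With p = y + y^* and q = i (y - y^* ) self-adjoint, p^2 + q^2 = 2 (y y^* + y^* y)
   is both positive and negative. *)
Lemma starM_negative_eq0 y : positive (- (star y * y)) -> y = 0.
Proof.
move=> pn; have pn' := positive_starM_swap pn.
pose p := y + star y; pose q := ('i : R[i]) *: (y - star y).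
have sp : star p = p by rewrite /p starD starK addrC.
have sq : star q = q.
  by rewrite /q starZ conjCi starB starK scaleNr -scalerN opprB.
have pqE : p * p + q * q = (2 : R)%:C *: (y * star y + star y * y).
  rewrite /q -scalerAl -scalerAr scalerA [X in _ + X *: _](_ : _ = -1); last exact: mulCii.
  rewrite scaleN1r.
  by rewrite rmorph_nat scaler_nat mulr2n /p; nring.
have pp := positive_sqr sp; have qq := positive_sqr sq.
have s0 : p * p + q * q = 0.
  apply: positive_anti; first exact: positiveD.
  rewrite pqE -scalerN opprD; apply: positiveZ; first by rewrite ler0n.
  exact: positiveD.
have p0 : p * p = 0.
  by apply: positive_anti => //; rewrite (_ : - _ = q * q)// -(addrK (q * q) (p * p)) s0 add0r opprK.
have q0 : q * q = 0 by move: s0; rewrite p0 add0r.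
have sa0 (v : A) : star v = v -> v * v = 0 -> v = 0.
  move=> sv v0; apply/eqP; rewrite -cnorm_eq0 -sqrf_eq0 -cnorm_sa_sqr// v0.
  by rewrite cnorm0.
have y2 : y + y = 0.
  have /eqP := sa0 _ sq q0; rewrite scaler_eq0 (negbTE (neq0Ci _)) /= subr_eq0.
  by move=> /eqP yE; rewrite {2}yE; exact: sa0.
apply/eqP; have /eqP := y2; rewrite -mulr2n -scaler_nat scaler_eq0.
by rewrite pnatr_eq0.
Qed.

(* Let a = y^* y and b = |a| - a.  Then b^2 = 2 |a| b makes b positive, and for
   g = b^(1/2) one gets (y g)^* (y g) = a b = - b^2 / 2, so y g = 0 and b = 0. *)
Theorem positive_starM y : positive (star y * y).
Proof.
set a := star y * y.
have sa : star a = a by rewrite /a starM starK.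
have [m [pm m2 cm]] := positive_sqrt (positive_sqr sa).
have am : a * m = m * a by apply: cm; rewrite mulrA.
pose b := m - a.
have sb : star b = b by rewrite /b starB sa pm.1.
have bb : b * b = b * m + b * m.
  have -> : b * b = m * m - m * a - a * m + a * a by rewrite /b; nring.
  by rewrite -m2 /b -am mulrBl; nring.
have bm : b * m = m * b by rewrite /b mulrBr mulrBl am.
(* By b^2 = 2 b m, (b - c)(b - 2 m + c) = 2 c (m - c/2), which is invertible unless c >= 0 because m
   is positive. The two factors commute, so b - c is then invertible. *)
have pb : positive b.
  split=> // c cb; apply: contraT => c0.
  have cn0 : c != 0 by apply: contra c0 => /eqP ->.
  set C : A := c%:A; have CC x : C * x = x * C by rewrite mulr_algl mulr_algr.
  have : (b - C) * (b - (m + m) + c%:A) \is a GRing.unit.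
    have [d cd dn] : exists2 d, c = d + d & ~~ (0 <= d).
      exists (c / 2); first by rewrite -splitr.
      by rewrite pmulr_lge0 ?invr_gt0 ?ltr0n.
    have -> : (b - C) * (b - (m + m) + C) = c *: (2%:R *: (m - d%:A)).
      transitivity (C * (m + m) - C * C).
        rewrite [LHS](_ : _ = b * b - (b * m + b * m) + b * C - C * b +
          C * (m + m) - C * C); last nring.
        by rewrite bb CC; nring.
      rewrite scaler_nat mulr2n addrACA -opprD -scalerDl -cd.
      by rewrite /C !mulr_algl scalerBr.
    rewrite !unitZ ?pnatr_eq0//; apply: contraT => /pm.2.
    by rewrite (negbTE dn).
  rewrite unitrM_comm; last first.
    rewrite /GRing.comm -/C [LHS](_ : _ = b * b - (b * m + b * m) + b * C - C * b +
          C * m + C * m - C * C); last nring.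
    rewrite [RHS](_ : _ = b * b - (m * b + m * b) - b * C + C * b +
          m * C + m * C - C * C); last nring.
    by rewrite bm -!CC; nring.
  by move=> /andP[bu _]; move: cb; rewrite /spectrum /= -/C bu.
have [g [pg g2 cg]] := positive_sqrt pb.
have ag : a * g = g * a by apply: cg; rewrite /b mulrBr mulrBl am.
have E : star (y * g) * (y * g) = - (2^-1%:C *: (b * b)).
  rewrite starM pg.1 -mulrA (mulrA (star y)) -/a ag mulrA g2 bb.
  rewrite scalerDr -scalerDl -rmorphD -[2^-1]mul1r -splitr rmorph1 scale1r.
  by rewrite /b !mulrBl m2 -am; nring.
have yg : y * g = 0.
  apply: starM_negative_eq0; rewrite E opprK; apply: positiveZ.
    by rewrite invr_ge0 ler0n.
  exact: positive_sqr.
have b0 : b = 0.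
  apply/eqP; rewrite -cnorm_eq0 -sqrf_eq0 -cnorm_sa_sqr//.
  move/eqP: E; rewrite yg mulr0 eq_sym oppr_eq0 scaler_eq0 => /orP[|/eqP ->].
    by rewrite -[0]/(0%:C) (inj_eq (@complexI _)) invr_eq0 pnatr_eq0.
  by rewrite cnorm0.
by rewrite (_ : a = m)//; apply/esym/eqP; rewrite -subr_eq0 -/b b0.
Qed.

(** In order terms, a >= t - t^2 n >= t (1 - t |n|) > 0. *)
Lemma unit_of_lower_bound a (n : A) t : 0 < t -> star n = n -> t * cnorm n < 1 ->
  positive (a - t%:C%:A + (t ^+ 2)%:C *: n) -> a \is a GRing.unit.
Proof.
move=> t0 sn tn pa.
have -> : a = (a - t%:C%:A + (t ^+ 2)%:C *: n) +
   (t ^+ 2)%:C *: ((cnorm n)%:C%:A - n) + (t - t ^+ 2 * cnorm n)%:C%:A.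
  rewrite scalerBr scalerA -rmorphM rmorphB scalerBl; nring.
apply: positive_unitD; first by rewrite expr2; nra.
apply: positiveD => //; apply: positiveZ; first exact: sqr_ge0.
exact: positive_cnorm_sub.
Qed.

End Positivity.

(** * The group U(theta_H) and its action on K_H *)

Section Symplectic.
Context (R : realType) (A : cstarAlgType R).
Implicit Types (h m : A) (x y : A * A) (a b : 'M[A]_2).

Lemma mulmx2E a b i j : (a *m b) i j = a i 0 * b 0 j + a i 1 * b 1 j.
Proof.
rewrite mxE big_ord_recl big_ord1.
by have -> : lift ord0 ord0 = 1 :> 'I_2 by apply: val_inj.
Qed.

Lemma mulmv_mulmx a b x : mulmv (a *m b) x = mulmv a (mulmv b x).
Proof. by rewrite /mulmv !mulmx2E /=; congr pair; nring. Qed.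

Lemma mulmv1 x : mulmv 1%:M x = x.
Proof. by case: x => x1 x2; rewrite /mulmv !mxE /= !mul1r !mul0r addr0 add0r. Qed.

Lemma eq_mx2 a b : a 0 0 = b 0 0 -> a 0 1 = b 0 1 -> a 1 0 = b 1 0 ->
  a 1 1 = b 1 1 -> a = b.
Proof.
move=> h00 h01 h10 h11; apply/matrixP => i j.
have ord2 (k : 'I_2) : k = 0 \/ k = 1.
  by case: k => -[|[|//]] ?; [left|right]; apply: val_inj.
by case: (ord2 i) => ->; case: (ord2 j) => ->.
Qed.

Lemma iV_neq0 : ('i : R[i])^-1 != 0.
Proof. by rewrite invr_eq0 neq0Ci. Qed.

Lemma thetaH_inj x y x' y' : thetaH x y = thetaH x' y' ->
  star x.1 * y.2 - star x.2 * y.1 = star x'.1 * y'.2 - star x'.2 * y'.1.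
Proof. by move/(scalerI iV_neq0). Qed.

Lemma UthetaH_entries a : UthetaH A a ->
  [/\ star (a 0 0) * a 1 0 = star (a 1 0) * a 0 0,
      star (a 0 1) * a 1 1 = star (a 1 1) * a 0 1 &
      star (a 0 0) * a 1 1 - star (a 1 0) * a 0 1 = 1].
Proof.
move=> [_ aU].
have := thetaH_inj (aU (1, 0) (1, 0)); have := thetaH_inj (aU (0, 1) (0, 1)).
have := thetaH_inj (aU (1, 0) (0, 1)).
rewrite /= !mulr1 !mulr0 ?addr0 ?add0r !star1 !star0 ?mul1r ?mul0r ?mulr0 !subr0.
by rewrite oppr0 => -> /subr0_eq -> /subr0_eq ->.
Qed.

(** This is J^-1 a^* J, where J has rows (0, 1) and (-1, 0) and [thetaH] is x^* J y / i. *)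
Definition symp_inv a : 'M[A]_2 := \matrix_(i < 2, j < 2)
  if i == 0 then if j == 0 then star (a 1 1) else - star (a 0 1)
  else if j == 0 then - star (a 1 0) else star (a 0 0).

Lemma symp_invE a : [/\ symp_inv a 0 0 = star (a 1 1),
  symp_inv a 0 1 = - star (a 0 1), symp_inv a 1 0 = - star (a 1 0) &
  symp_inv a 1 1 = star (a 0 0)].
Proof. by rewrite /symp_inv !mxE. Qed.

Lemma symp_inv_mul a :
  star (a 0 0) * a 1 0 = star (a 1 0) * a 0 0 ->
  star (a 0 1) * a 1 1 = star (a 1 1) * a 0 1 ->
  star (a 0 0) * a 1 1 - star (a 1 0) * a 0 1 = 1 ->
  symp_inv a *m a = 1%:M.
Proof.
move=> h0 h1 h01; have [e00 e01 e10 e11] := symp_invE a.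
have h10 : star (a 1 1) * a 0 0 - star (a 0 1) * a 1 0 = 1.
  by rewrite -[RHS]star1 -h01 starB !starM !starK.
apply: eq_mx2; rewrite mulmx2E ?e00 ?e01 ?e10 ?e11 [RHS]mxE /= ?mulNr.
- by rewrite h10.
- by rewrite h1 subrr.
- by rewrite h0 addNr.
- by rewrite addrC h01.
Qed.

(** Preservation of the form yields a left inverse; invertibility of a makes it two-sided. The
    product in the other order carries the relations between rows of a. *)
Lemma UthetaH_inv a : UthetaH A a ->
  a *m symp_inv a = 1%:M /\ symp_inv a *m a = 1%:M.
Proof.
move=> aU; have [h0 h1 h01] := UthetaH_entries aU.
have inv_a := symp_inv_mul h0 h1 h01; split=> //.
have [[b [ab ba]] _] := aU.
suff -> : symp_inv a = b by [].
by rewrite -[LHS]mulmx1 -ab mulmxA inv_a mul1mx.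
Qed.

Lemma UthetaH1 : UthetaH A 1%:M.
Proof.
split; first by exists 1%:M; rewrite mulmx1.
by move=> x y; rewrite !mulmv1.
Qed.

Lemma UthetaHM a b : UthetaH A a -> UthetaH A b -> UthetaH A (a *m b).
Proof.
move=> [[a' [aa' a'a]] aU] [[b' [bb' b'b]] bU]; split.
  exists (b' *m a'); split.
    by rewrite -mulmxA (mulmxA b) bb' mul1mx.
  by rewrite -mulmxA (mulmxA a') a'a mul1mx.
by move=> x y; rewrite !mulmv_mulmx aU bU.
Qed.

Lemma subgroup_Borel : subgroup_of (Borel A) (UthetaH A).
Proof.
split.
- by move=> a [].
- by split; [exact: UthetaH1|rewrite mxE].
- move=> a b [aU a0] [bU b0]; split; first exact: UthetaHM.
  by rewrite mulmx2E a0 b0 mulr0 mul0r addr0.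
- move=> a [aU a0]; have [ai ia] := UthetaH_inv aU.
  exists (symp_inv a) => //; split.
    split; first by exists a.
    by move=> x y; rewrite -aU.2 -!mulmv_mulmx ai !mulmv1.
  by have [_ -> _ _] := symp_invE a; rewrite a0 star0 oppr0.
Qed.

Lemma KHE x : KH A x <->
  star x.1 * x.2 - star x.2 * x.1 = ('i : R[i])%:A /\ x.1 \is a GRing.unit.
Proof.
rewrite /KH /thetaH /=; split => -[e xu]; split=> //.
  by rewrite -e scalerA divff ?neq0Ci// scale1r.
by rewrite e scalerA mulVf ?neq0Ci// scale1r.
Qed.

Lemma Borel_transitive x y : KH A x -> KH A y ->
  exists2 b, Borel A b & mulmv b x = y.
Proof.
move=> /KHE[xE xu] /KHE[yE yu].
pose b0 := y.1 * x.1^-1; have b0u : b0 \is a GRing.unit by rewrite unitrMl ?unitrV.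
(* The relation [star b0 * b1 = 1] forces b1, and the second coordinate of y forces b2. *)
pose b1 := star b0^-1; pose b2 := (y.2 - b1 * x.2) * x.1^-1.
pose b : 'M[A]_2 := \matrix_(i < 2, j < 2)
  if i == 0 then if j == 0 then b0 else 0 else if j == 0 then b2 else b1.
have e00 : b 0 0 = b0 by rewrite mxE.
have e01 : b 0 1 = 0 by rewrite mxE.
have e10 : b 1 0 = b2 by rewrite mxE.
have e11 : b 1 1 = b1 by rewrite mxE.
have b01 : star b0 * b1 = 1 by rewrite -starM mulVr ?star1.
have b10 : b1 * star b0 = 1 by rewrite -starM divrr ?star1.
(* Membership of x and y in [KH] enters here: the anti-self-adjoint part of b0^* b2 is the
   difference of x_1^-* (y_1^* y_2 - y_2^* y_1) x_1^-1 and the same expression in x, and both middle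
   factors equal i. *)
have b0b2 : star b0 * b2 = star b2 * b0.
  have x1K : star x.1^-1 * star x.1 = 1 by rewrite -starM divrr ?star1.
  have l : star b0 * b2 = star x.1^-1 * (star y.1 * y.2) * x.1^-1 - x.2 * x.1^-1.
    rewrite /b2 [LHS](_ : _ = star b0 * y.2 * x.1^-1 - (star b0 * b1) * x.2 * x.1^-1).
      by rewrite b01 /b0 starM; nring.
    by nring.
  have r : star b2 * b0 = star x.1^-1 * (star y.2 * y.1) * x.1^-1 - star (x.2 * x.1^-1).
    by rewrite -[star b2 * b0]starK starM starK l starB !starM !starK; nring.
  apply/eqP; rewrite -subr_eq0 l r starM; apply/eqP.
  have -> : star x.1^-1 * (star y.1 * y.2) * x.1^-1 - x.2 / x.1 -
     (star x.1^-1 * (star y.2 * y.1) * x.1^-1 - star x.1^-1 * star x.2) =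
     star x.1^-1 * (star y.1 * y.2 - star y.2 * y.1) * x.1^-1 -
     (star x.1^-1 * star x.1 * x.2 * x.1^-1 - star x.1^-1 * star x.2 * (x.1 / x.1)).
    by rewrite x1K divrr//; nring.
  by rewrite yE -xE; nring.
exists b; last first.
  rewrite /mulmv e00 e01 e10 e11 mul0r addr0 /b0 /b2 !mulrVK//.
  by rewrite subrK; case: y {yE yu b0 b0u b1 b2 b e00 e01 e10 e11 b01 b10 b0b2}.
have sb : symp_inv b *m b = 1%:M.
  apply: symp_inv_mul; rewrite ?e00 ?e01 ?e10 ?e11 ?star0 ?mulr0 ?mul0r ?subr0//.
have [s00 s01 s10 s11] := symp_invE b.
split=> //; split.
  exists (symp_inv b); split => //; apply: eq_mx2; rewrite mulmx2E [RHS]mxE /=.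
  - by rewrite s00 e00 e01 e11 mul0r addr0 -[b0]starK -starM b10 star1.
  - by rewrite s01 e00 e01 star0 oppr0 mulr0 mul0r addr0.
  - rewrite e10 e11 s00 s10 e10 e11 mulrN; apply/eqP; rewrite subr_eq0; apply/eqP.
    rewrite {1}/b1 starK; apply: (mulIr b0u).
    by rewrite mulrVK// -mulrA -b0b2 mulrA b10 mul1r.
  - by rewrite s01 s11 e01 e00 e11 star0 oppr0 mulr0 add0r b10.
move=> z w; rewrite /thetaH /mulmv /= e00 e01 e10 e11 !mul0r !addr0.
congr (_ *: _); clearbody b b2 b1 b0; rewrite !starD !starM.
have -> : star z.1 * star b0 * (b2 * w.1 + b1 * w.2) -
   (star z.1 * star b2 + star z.2 * star b1) * (b0 * w.1) =
   star z.1 * (star b0 * b2 - star b2 * b0) * w.1 + star z.1 * (star b0 * b1) * w.2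
   - star z.2 * (star b1 * b0) * w.1 by nring.
have -> : star b1 * b0 = 1 by rewrite -[b0]starK -starM b01 star1.
by rewrite b0b2 b01; nring.
Qed.

Lemma Borel_free b x : Borel A b -> KH A x -> mulmv b x = x -> b = 1%:M.
Proof.
move=> [bU b0] [_ xu]; case: x xu => x1 x2 /= xu []; rewrite b0 mul0r addr0.
have [_ _ h01] := UthetaH_entries bU.
rewrite -{2}[x1]mul1r => /(mulIr xu) e00; move: h01.
rewrite b0 e00 star1 mul1r mulr0 subr0 => e11.
rewrite e11 mul1r -{2}[x2]add0r => /addIr/(canRL (mulrK xu)); rewrite mul0r => e10.
by apply: eq_mx2; rewrite mxE.
Qed.

(** The sum of the squares of z - t k and z' - t k' is positive and equals the given element minus t
    plus t^2 n. The choice of t ensures t |n| < 1. Two pairs are needed for d d^*, a sum of two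
    squares. *)
Lemma unit_sum_starM (z k z' k' : A) :
  star z * k + star k * z + (star z' * k' + star k' * z') = 1 ->
  star z * z + star z' * z' \is a GRing.unit.
Proof.
move=> zk; pose n := star k * k + star k' * k'.
have sn : star n = n by rewrite /n starD !starM !starK.
pose t := (cnorm n + 1)^-1.
have n0 := cnorm_ge0 n.
have t0 : 0 < t by rewrite invr_gt0 ltr_wpDl.
apply: (@unit_of_lower_bound _ _ _ n t) => //.
  by rewrite mulrC ltr_pdivrMr ?mul1r ?ltrDl// ltr_wpDl.
have -> : star z * z + star z' * z' - t%:C%:A + (t ^+ 2)%:C *: n =
  star (z - t%:C *: k) * (z - t%:C *: k) + star (z' - t%:C *: k') * (z' - t%:C *: k').
  rewrite !starB !starZr -zk /n !scalerDr expr2 rmorphM -!scalerA.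
  rewrite !mulrBl !mulrBr -!scalerAl -!scalerAr.
  nring.
by apply: positiveD; exact: positive_starM.
Qed.

(** One condition gives a left inverse, the other a right inverse; a non-surjective isometry
    satisfies only the first. *)
Lemma unit_of_starM (d : A) : star d * d \is a GRing.unit ->
  d * star d \is a GRing.unit -> d \is a GRing.unit.
Proof.
move=> lu ru; pose l := (star d * d)^-1 * star d; pose r := star d * (d * star d)^-1.
have ld : l * d = 1 by rewrite /l -mulrA mulVr.
have dr : d * r = 1 by rewrite /r mulrA divrr.
apply/unitrP; exists l; split=> //.
by suff -> : l = r by []; rewrite -[l]mulr1 -dr mulrA ld mul1r.
Qed.

Definition base_point : A * A := (1, (2^-1 : R)%:C *: (('i : R[i])%:A)).

Lemma base_point_KH : KH A base_point.
Proof.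
apply/KHE; rewrite /base_point /= unitr1; split=> //.
rewrite star1 mul1r mulr1 starZr starZ star1 conjCi scaleNr scalerN opprK.
by rewrite -scalerDl -rmorphD -[2^-1]mul1r -splitr rmorph1 scale1r.
Qed.

(* For d = a_11 + (i/2) a_12 (indices from 1), a a^-1 = 1 makes a_11 a_12^* self-adjoint,
   so that d d^* = a_11 a_11^* + a_12 a_12^* / 4. *)
Lemma UthetaH_base_unit a : UthetaH A a ->
  (mulmv a base_point).1 \is a GRing.unit.
Proof.
move=> aU; have [h0 h1 h01] := UthetaH_entries aU.
have [ai ia] := UthetaH_inv aU; have [s00 s01 s10 s11] := symp_invE a.
have r00 : a 0 0 * star (a 1 1) - a 0 1 * star (a 1 0) = 1.
  by have /matrixP/(_ 0 0) := ai; rewrite mulmx2E s00 s10 [RHS]mxE /= mulrN.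
have r01 : a 0 0 * star (a 0 1) = a 0 1 * star (a 0 0).
  have /matrixP/(_ 0 1) := ai; rewrite mulmx2E s01 s11 [RHS]mxE /= mulrN addrC.
  by move/subr0_eq.
set y := mulmv a base_point; set d := y.1.
have yy : star d * y.2 - star y.2 * d = ('i : R[i])%:A.
  have /KHE[<- _] := base_point_KH.
  by apply: thetaH_inj; rewrite aU.2.
apply: unit_of_starM.
  rewrite -[_ * _]addr0 -[0](mulr0 (star 0)).
  (* The required pairing is [yy] divided by i, with a zero second pair. *)
  apply: (@unit_sum_starM _ (('i : R[i])^-1 *: y.2) _ 0).
  rewrite !mulr0 !addr0 starZ -scalerAr -scalerAl.
  have -> : (('i : R[i])^-1)^*%R = - ('i)^-1 by rewrite fmorphV [X in X^-1](_ : _ = - 'i) ?invrN//; exact: conjCi.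
  by rewrite scaleNr -scalerBr yy scalerA mulVf ?neq0Ci// scale1r.
have -> : d * star d = star (star (a 0 0)) * star (a 0 0) +
   star ((2^-1 : R)%:C *: star (a 0 1)) * ((2^-1 : R)%:C *: star (a 0 1)).
  pose c : R[i] := (2^-1 : R)%:C * 'i.
  have dE : d = a 0 0 + c *: a 0 1.
    by rewrite /d /y /base_point /mulmv /= mulr1 scalerA mulr_algr.
  have sdE : star d = star (a 0 0) - c *: star (a 0 1).
    rewrite dE starD starZ -scaleNr; congr (_ + _ *: _).
    have -> : c = (0 +i* 2^-1)%C.
      rewrite /c -complexiE; apply/eqP; rewrite eq_complex /=.
      by apply/andP; split; apply/eqP; ring.
    by rewrite -[LHS]/(conjc _) /=; apply/eqP; rewrite eq_complex /= oppr0 !eqxx.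
  have cc : c * c = - (2^-1 * 2^-1 : R)%:C.
    by rewrite /c mulrACA [X in _ * X](_ : _ = -1) ?mulrN1 -?rmorphM//; exact: mulCii.
  rewrite sdE dE mulrDl !mulrBr -!scalerAl -!scalerAr r01 scalerA cc starZr !starK.
  by rewrite scaleNr opprK addrA subrK -scalerAl scalerA -rmorphM.
(* Half of the row relation [r00] plus its adjoint is the required pairing. *)
apply: (@unit_sum_starM _ ((2^-1 : R)%:C *: star (a 1 1)) _ (- star (a 1 0))).
have hE : a 0 0 * ((2^-1 : R)%:C *: star (a 1 1)) +
    ((2^-1 : R)%:C *: a 0 1) * (- star (a 1 0)) = (2^-1 : R)%:C%:A.
  by rewrite mulrN -scalerAr -scalerAl -scalerBr r00.
rewrite addrACA; set P := (X in X + _ = _); set Q := (X in P + X = _).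
have -> : Q = star P by rewrite /Q /P starD !starM !starK.
have -> : P = (2^-1 : R)%:C%:A by rewrite /P starZr !starK.
by rewrite sa_scalar -scalerDl -rmorphD -[2^-1]mul1r -splitr rmorph1 scale1r.
Qed.

(** Since x = b [base_point] with b in the subgroup, a x = (a b) [base_point], and the invertibility
    of the first entry is known at that point. *)
Lemma UthetaH_acts : acts_on (UthetaH A) (KH A).
Proof.
move=> a x aU Kx; split; first by rewrite aU.2; case: Kx.
have [b [bU _] <-] := Borel_transitive base_point_KH Kx.
by rewrite -mulmv_mulmx UthetaH_base_unit//; exact: UthetaHM.
Qed.

Lemma UthetaH_covariant a x : UthetaH A a -> KH A x ->
  [/\ KH A (mulmv a x), a 0 0 + a 0 1 * phi x \is a GRing.unit &
      phi (mulmv a x) = moebius a (phi x)].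
Proof.
move=> aU Kx; have Kax := UthetaH_acts aU Kx; have [_ xu] := Kx.
have dE : (mulmv a x).1 = (a 0 0 + a 0 1 * phi x) * x.1.
  by rewrite /mulmv /phi /= mulrDl -!mulrA mulVr// mulr1.
have du : a 0 0 + a 0 1 * phi x \is a GRing.unit.
  by rewrite -(unitrMl _ xu) -dE; case: Kax.
split=> //; rewrite {1}/phi dE invrM// mulrA /moebius; congr (_ * _).
by rewrite /mulmv /phi /= mulrDl !mulrA mulrK.
Qed.

Lemma iV_sub_im_part h : im_part h = (2^-1 : R)%:C *: (('i : R[i])^-1 *: (h - star h)).
Proof.
rewrite /im_part scalerA; congr (_ *: _).
by rewrite invfM fmorphV rmorph_nat.
Qed.

Lemma phi_upper_half x : KH A x -> upper_half A (phi x).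
Proof.
move=> /KHE[xE xu].
have e : im_part (phi x) = (2^-1 : R)%:C *: (star x.1^-1 * x.1^-1).
  rewrite iV_sub_im_part; congr (_ *: _).
  have x1K : star x.1^-1 * star x.1 = 1 by rewrite -starM divrr ?star1.
  have -> : phi x - star (phi x) = star x.1^-1 * (star x.1 * x.2 - star x.2 * x.1) / x.1.
    have -> : star x.1^-1 * (star x.1 * x.2 - star x.2 * x.1) / x.1 =
       star x.1^-1 * star x.1 * (x.2 / x.1) - star x.1^-1 * star x.2 * (x.1 / x.1) by nring.
    by rewrite x1K mul1r divrr// mulr1 /phi starM.
  rewrite xE -scalerAr mulr1 -scalerAl scalerA mulVf ?neq0Ci// scale1r//.
rewrite /upper_half /= e; split.
  rewrite unitZ; last by rewrite fmorph_eq0 invr_eq0 pnatr_eq0.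
  by rewrite unitrMl ?star_unit unitrV.
by apply: positiveZ; [rewrite invr_ge0 ler0n|exact: positive_starM].
Qed.

Lemma section_KH h m : star m = m -> m \is a GRing.unit ->
  m * m = ('i : R[i])^-1 *: (h - star h) -> KH A (m^-1, h * m^-1).
Proof.
move=> sm mu m2; split; rewrite /= ?unitrV// /thetaH /= starM starV sm.
have -> : m^-1 * (h / m) - m^-1 * star h / m = m^-1 * (h - star h) / m by nring.
by rewrite scalerAl scalerAr -m2 -!mulrA divrr// mulr1 mulVr.
Qed.

End Symplectic.

(** * Calculus in normed spaces *)

Section Operators.
Context (R : realType).
Implicit Types (E F G H : normedModType R).

Lemma op_normE E F (L : bounded_op E F) : `|L| = op_norm L.
Proof. by []. Qed.

Lemma op_bound E F (L : bounded_op E F) x : `|L x| <= `|L| * `|x|.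
Proof. exact: op_norm_bound. Qed.

Fact bounded_linear_continuous E F (f : E -> F) (lf : linear f) (M : R) :
  (forall x, `|f x| <= M * `|x|) -> continuous f.
Proof.
move=> fM x; apply/cvgrPdist_le => e e0.
have M0 : 0 < `|M| + 1 by rewrite ltr_wpDl.
near=> y.
have fB : f x - f y = f (x - y).
  by rewrite (addrC x) -(scaleN1r y) lf scaleN1r addrC.
rewrite fB (le_trans (fM _))// (@le_trans _ _ ((`|M| + 1) * `|x - y|))//.
  by rewrite ler_wpM2r// (le_trans (ler_norm _))// lerDl.
rewrite mulrC -ler_pdivlMr//; near: y.
by apply: cvgr_dist_le; [exact: cvg_id|rewrite divr_gt0].
Unshelve. all: by end_near. Qed.

Definition mkop E F (f : E -> F) (lf : linear f) (M : R)
  (fM : forall x, `|f x| <= M * `|x|) : bounded_op E F :=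
  BoundedOp lf (bounded_linear_continuous lf fM).

Lemma op_norm_le_bound E F (L : bounded_op E F) (M : R) : 0 <= M ->
  (forall x, `|L x| <= M * `|x|) -> `|L| <= M.
Proof.
move=> M0 LM; rewrite op_normE; apply: op_norm_le => x x1.
by rewrite (le_trans (LM x))// ler_piMr.
Qed.

Section Bilinear.
Context E F G (B : E -> F -> G) (Bl : forall y, linear (B^~ y))
  (Br : forall x, linear (B x)) (M : R)
  (BM : forall x y, `|B x y| <= M * `|x| * `|y|).

Definition bil_right x : bounded_op F G := mkop (@Br x) (BM x).

Fact bil_right_linear : linear bil_right.
Proof. by move=> c x x'; apply: bounded_op_eq => y /=; rewrite Bl. Qed.

Fact bil_right_bound x : `|bil_right x| <= `|M| * `|x|.
Proof.
apply: op_norm_le_bound; first by rewrite mulr_ge0.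
by move=> y; rewrite (le_trans (BM x y))// ler_wpM2r// ler_wpM2r// ler_norm.
Qed.

Definition mkbil : bounded_op E (bounded_op F G) :=
  mkop bil_right_linear bil_right_bound.

End Bilinear.

Lemma bil_bound E F G (B : bounded_op E (bounded_op F G)) x y :
  `|B x y| <= `|B| * `|x| * `|y|.
Proof. by rewrite (le_trans (op_bound _ _))// ler_wpM2r// op_bound. Qed.

Fact comp_linear E F G (M : bounded_op F G) (L : bounded_op E F) :
  linear (fun x => M (L x)).
Proof. by move=> c x y; rewrite !linearP. Qed.

Fact comp_bound E F G (M : bounded_op F G) (L : bounded_op E F) x :
  `|M (L x)| <= `|M| * `|L| * `|x|.
Proof. by rewrite (le_trans (op_bound _ _))// -mulrA ler_wpM2l// op_bound. Qed.

Definition comp_op E F G (M : bounded_op F G) (L : bounded_op E F) :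
  bounded_op E G := mkop (comp_linear M L) (comp_bound M L).

Lemma comp_op_norm E F G (M : bounded_op F G) (L : bounded_op E F) :
  `|comp_op M L| <= `|M| * `|L|.
Proof. by apply: op_norm_le_bound; [exact: mulr_ge0|exact: comp_bound]. Qed.

Fact comp_op_linearl E F G (L : bounded_op E F) :
  linear (fun M : bounded_op F G => comp_op M L).
Proof. by move=> c M M'; apply: bounded_op_eq. Qed.

Fact comp_op_linearr E F G (M : bounded_op F G) :
  linear (fun L : bounded_op E F => comp_op M L).
Proof. by move=> c L L'; apply: bounded_op_eq => x /=; rewrite linearP. Qed.

Fact comp_op_bound E F G (M : bounded_op F G) (L : bounded_op E F) :
  `|comp_op M L| <= 1 * `|M| * `|L|.
Proof. by rewrite mul1r comp_op_norm. Qed.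

Definition comp_bil E F G :
    bounded_op (bounded_op F G) (bounded_op (bounded_op E F) (bounded_op E G)) :=
  mkbil (@comp_op_linearl E F G) (@comp_op_linearr E F G) (@comp_op_bound E F G).

Section BilinearDerivative.
Context E F G H (B : bounded_op F (bounded_op G H)).

Fact bil_left_linear y : linear (fun x => B x y).
Proof. by move=> c x x'; rewrite linearP. Qed.

Fact bil_left_bound y x : `|B x y| <= `|B| * `|y| * `|x|.
Proof. by rewrite mulrAC bil_bound. Qed.

Definition bil_left y : bounded_op F H :=
  mkop (@bil_left_linear y) (@bil_left_bound y).

Fact bil_left_op_linearl (y : G) : linear (fun T : bounded_op E F => comp_op (bil_left y) T).
Proof. exact: comp_op_linearr. Qed.

Fact bil_left_op_linearr (T : bounded_op E F) : linear (fun y => comp_op (bil_left y) T).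
Proof. by move=> c y y'; apply: bounded_op_eq => x /=; rewrite linearP. Qed.

Fact bil_left_op_bound (T : bounded_op E F) y :
  `|comp_op (bil_left y) T| <= `|B| * `|T| * `|y|.
Proof.
rewrite (le_trans (comp_op_norm _ _))// mulrAC ler_wpM2r//.
by apply: op_norm_le_bound; [exact: mulr_ge0|exact: bil_left_bound].
Qed.

(** The product rule has summands h |-> B (Df h) g and h |-> B f (Dg h). This definition and
    [bil_comp_right] present them as bounded bilinear in (Df, g) and in (f, Dg), ready for another
    differentiation. *)
Definition bil_comp_left : bounded_op (bounded_op E F) (bounded_op G (bounded_op E H)) :=
  mkbil bil_left_op_linearl bil_left_op_linearr bil_left_op_bound.

Fact bil_right_op_linearl (T : bounded_op E G) : linear (fun x => comp_op (B x) T).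
Proof. by move=> c y y'; apply: bounded_op_eq => x /=; rewrite linearP. Qed.

Fact bil_right_op_bound x (T : bounded_op E G) :
  `|comp_op (B x) T| <= `|B| * `|x| * `|T|.
Proof. by rewrite (le_trans (comp_op_norm _ _))// ler_wpM2r// op_bound. Qed.

Definition bil_comp_right : bounded_op F (bounded_op (bounded_op E G) (bounded_op E H)) :=
  mkbil bil_right_op_linearl (fun x => @comp_op_linearr E G H (B x)) bil_right_op_bound.

End BilinearDerivative.

End Operators.

(** * Frechet derivatives: chain rule and product rule *)

Section Frechet.
Context (R : realType).
Implicit Types (E F G H : normedModType R).

Lemma opD E F (L : bounded_op E F) x y : L (x + y) = L x + L y.
Proof. exact: linearD. Qed.

Lemma opN E F (L : bounded_op E F) x : L (- x) = - L x.
Proof. exact: linearN. Qed.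

Lemma opB E F (L : bounded_op E F) x y : L (x - y) = L x - L y.
Proof. exact: linearB. Qed.

Lemma op_addE E F (L M : bounded_op E F) x : (L + M) x = L x + M x.
Proof. by []. Qed.

Lemma op_subE E F (L M : bounded_op E F) x : (L - M) x = L x - M x.
Proof. by rewrite op_addE /= scaleN1r. Qed.

Lemma op_oppE E F (L : bounded_op E F) x : (- L) x = - L x.
Proof. by rewrite -[RHS]scaleN1r. Qed.

(** An epsilon form with the derivative given as a bounded operator; the next two lemmas translate
    to and from [differentiable] and ['d]. *)
Definition frechet E F (f : E -> F) (x : E) (L : bounded_op E F) :=
  forall e : R, 0 < e -> \forall y \near x, `|f y - f x - L (y - x)| <= e * `|y - x|.

Lemma frechet_differentiable E F (f : E -> F) x (L : bounded_op E F) :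
  frechet f x L -> differentiable f x /\ 'd f x = L :> (E -> F).
Proof.
move=> fL.
have o : f \o shift x = cst (f x) + L +o_ 0 id.
  apply/eqaddoP => e e0.
  have : \forall h \near (0 : E), `|f (h + x) - f x - L (h + x - x)| <= e * `|h + x - x|.
    by have := fL e e0; rewrite (near_shift 0) subr0.
  apply: filterS => h; rewrite addrK /= /cst /=.
  by rewrite !fctE opprD addrA.
have cL := @bounded_op_continuous _ _ _ L.
have dE := diff_unique cL o.
split; last by [].
by apply/diff_locallyP; rewrite dE; split.
Qed.

Lemma differentiable_frechet E F (f : E -> F) x (L : bounded_op E F) :
  differentiable f x -> L = 'd f x :> (E -> F) -> frechet f x L.
Proof.
move=> /diff_locallyP[_ o] dE e e0; move: o; rewrite -dE => /eqaddoP/(_ e e0) o.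
rewrite (near_shift 0) subr0; apply: filterS o => h.
by rewrite /= /cst /= addrK !fctE opprD addrA.
Qed.

Lemma frechet_continuous E F (f : E -> F) x (L : bounded_op E F) :
  frechet f x L -> {for x, continuous f}.
Proof. by move=> /frechet_differentiable[/differentiable_continuous]. Qed.

Lemma frechet_op E F (L : bounded_op E F) x : frechet L x L.
Proof.
move=> e e0; apply: nearW => y; rewrite -linearB subrr normr0.
by rewrite mulr_ge0// ltW.
Qed.

Lemma frechet_cst E F (c : F) (x : E) : frechet (fun=> c) x 0.
Proof.
move=> e e0; apply: nearW => y; rewrite subrr sub0r normrN normr0.
by rewrite mulr_ge0// ltW.
Qed.

Lemma frechetD E F (f g : E -> F) x (L M : bounded_op E F) :
  frechet f x L -> frechet g x M -> frechet (fun y => f y + g y) x (L + M).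
Proof.
move=> fL gM e e0; have e2 := divr_gt0 e0 (ltr0n R 2).
near=> y.
have -> : f y + g y - (f x + g x) - (L + M) (y - x) =
    (f y - f x - L (y - x)) + (g y - g x - M (y - x)).
  rewrite op_addE.
  by rewrite opprD addrACA opprD [LHS]addrACA.
rewrite (le_trans (ler_normD _ _))// [e]splitr mulrDl lerD//; near: y.
  exact: fL.
exact: gM.
Unshelve. all: by end_near. Qed.

Lemma frechet_comp E F G (f : E -> F) (g : F -> G) x (L : bounded_op E F)
  (M : bounded_op F G) : frechet f x L -> frechet g (f x) M ->
  frechet (fun y => g (f y)) x (comp_op M L).
Proof.
move=> /frechet_differentiable[df fL] /frechet_differentiable[dg gM].
rewrite -[fun y => g (f y)]/(g \o f); apply: differentiable_frechet.
  exact: differentiable_comp.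
by rewrite diff_comp// fL gM.
Qed.

Fact sub_bilE (V : zmodType) (p q r s l m : V) :
  p - q - (l + m) = (r - q - l) + (s - q - m) + (p - r - (s - q)).
Proof.
have -> : p - r - (s - q) = (p - q) - ((r - q) + (s - q)).
  by rewrite [in RHS]opprD addrA; congr (_ - _); rewrite opprB addrA subrK.
by rewrite [X in _ = X + _]addrACA -opprD [RHS]addrC addrA subrK.
Qed.

(** The error is B (r_f) g + B f (r_g) + B (Delta f) (Delta g), with r the first-order remainders; K
    collects the three coefficients. *)
Lemma frechet_bil E F G H (B : bounded_op F (bounded_op G H))
  (f : E -> F) (g : E -> G) x (L : bounded_op E F) (M : bounded_op E G) :
  frechet f x L -> frechet g x M ->
  frechet (fun y => B (f y) (g y)) x
    (bil_comp_left E B L (g x) + bil_comp_right E B (f x) M).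
Proof.
move=> fL gM e e0.
pose K := `|B| * (`|g x| + `|f x| + `|L| + 1) + 1.
have K0 : 0 < K by rewrite ltr_wpDl// mulr_ge0// !addr_ge0.
pose d := Num.min 1 (e / K).
have d0 : 0 < d by rewrite lt_min ltr01 divr_gt0.
have dK : d * K <= e by rewrite -ler_pdivlMr// ge_min lexx orbT.
have d1 : d <= 1 by rewrite ge_min lexx.
near=> y.
have fy : `|f y - f x - L (y - x)| <= d * `|y - x| by near: y; exact: fL.
have gy : `|g y - g x - M (y - x)| <= d * `|y - x| by near: y; exact: gM.
have gc : `|g y - g x| <= d.
  near: y; under eq_near do rewrite distrC.
  by apply: cvgr_dist_le => //; exact: frechet_continuous gM.
have fyx : `|f y - f x| <= (`|L| + 1) * `|y - x|.
  have -> : f y - f x = (f y - f x - L (y - x)) + L (y - x) by rewrite subrK.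
  rewrite (le_trans (ler_normD _ _))// addrC mulrDl lerD ?op_bound//.
  by rewrite (le_trans fy)// ler_wpM2r.
have -> : B (f y) (g y) - B (f x) (g x) -
    (bil_comp_left E B L (g x) + bil_comp_right E B (f x) M) (y - x) =
    B (f y - f x - L (y - x)) (g x) + B (f x) (g y - g x - M (y - x)) +
    B (f y - f x) (g y - g x).
  have Bl a b c : B (a - b) c = B a c - B b c by rewrite linearB /= scaleN1r.
  rewrite op_addE [bil_comp_left _ _ _ _ _]/= [bil_comp_right _ _ _ _ _]/=.
  move: (L (y - x)) (M (y - x)) => l m; rewrite !Bl !linearB /=.
  by rewrite -[- _ - - _]opprD; exact: sub_bilE.
rewrite (le_trans (ler_normD _ _))// (le_trans (lerD (ler_normD _ _) (lexx _)))//.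
have h1 : `|B (f y - f x - L (y - x)) (g x)| <= `|B| * (d * `|y - x|) * `|g x|.
  by rewrite (le_trans (bil_bound _ _ _))// ler_wpM2r// ler_wpM2l.
have h2 : `|B (f x) (g y - g x - M (y - x))| <= `|B| * `|f x| * (d * `|y - x|).
  by rewrite (le_trans (bil_bound _ _ _))// ler_wpM2l// mulr_ge0.
have h3 : `|B (f y - f x) (g y - g x)| <= `|B| * ((`|L| + 1) * `|y - x|) * d.
  rewrite (le_trans (bil_bound _ _ _))//.
  by rewrite ler_pM ?mulr_ge0// ler_wpM2l.
rewrite (le_trans (lerD (lerD h1 h2) h3))// (@le_trans _ _ (d * K * `|y - x|))//.
  rewrite /K; have : 0 <= d * `|y - x| by rewrite mulr_ge0// ltW.
  lra.
by rewrite ler_wpM2r.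
Unshelve. all: by end_near. Qed.

End Frechet.

(** * Maps of class C^k: sums and bilinear products *)

Section Smooth.
Context (R : realType) (E : normedModType R).
Implicit Types (F G H : normedModType R) (U V : set E).

Lemma CkSP F U k (f : E -> F) : Ck k.+1 U f <->
  exists2 Df : E -> bounded_op E F, (forall x, U x -> frechet f x (Df x)) & Ck k U Df.
Proof.
split=> /= [[df [Df [DfE Dfk]]]|[Df fDf Dfk]].
  exists Df => // x Ux; apply: differentiable_frechet; first exact: df.
  exact: DfE.
split; first by move=> x /fDf/frechet_differentiable[].
by exists Df; split=> // x /fDf/frechet_differentiable[].
Qed.

Lemma Ck_cst F U k (c : F) : Ck k U (fun=> c).
Proof.
elim: k F c => [|k IH] F c; first by move=> x _; exact: cvg_cst.
by apply/CkSP; exists (fun=> 0) => // x _; exact: frechet_cst.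
Qed.

Lemma Ck_op F U k (L : bounded_op E F) : Ck k U L.
Proof.
case: k => [|k]; first by move=> x _; exact: bounded_op_continuous.
by apply/CkSP; exists (fun=> L); [move=> x _; exact: frechet_op|exact: Ck_cst].
Qed.

Lemma CkS_Ck F U k (f : E -> F) : Ck k.+1 U f -> Ck k U f.
Proof.
elim: k F f => [|k IH] F f.
  by move=> /CkSP[Df fDf _] x /fDf/frechet_continuous.
by move=> /CkSP[Df fDf Dfk]; apply/CkSP; exists Df => //; exact: IH.
Qed.

Lemma CkD F U k (f g : E -> F) : Ck k U f -> Ck k U g -> Ck k U (fun x => f x + g x).
Proof.
elim: k F f g => [|k IH] F f g.
  by move=> fc gc x Ux; apply: cvgD; [exact: fc|exact: gc].
move=> /CkSP[Df fDf Dfk] /CkSP[Dg gDg Dgk]; apply/CkSP.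
exists (fun x => Df x + Dg x); last exact: IH.
by move=> x Ux; apply: frechetD; [exact: fDf|exact: gDg].
Qed.

Lemma Ck_bil F G H U k (B : bounded_op F (bounded_op G H)) (f : E -> F) (g : E -> G) :
  Ck k U f -> Ck k U g -> Ck k U (fun x => B (f x) (g x)).
Proof.
elim: k F G H B f g => [|k IH] F G H B f g.
  move=> fc gc x Ux.
  have cB : {for x, continuous (fun y => B (f y))}.
    by apply: continuous_comp; [exact: fc|exact: bounded_op_continuous].
  apply/cvgrPdist_le => e e0.
  have K0 : 0 < `|B| * (`|f x| + 1) + `|g x| + 1 by rewrite ltr_wpDl// addr_ge0// mulr_ge0// addr_ge0.
  pose d := Num.min 1 (e / (`|B| * (`|f x| + 1) + `|g x| + 1)).
  have d0 : 0 < d by rewrite lt_min ltr01 divr_gt0.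
  have dK : d * (`|B| * (`|f x| + 1) + `|g x| + 1) <= e.
    by rewrite -ler_pdivlMr// ge_min lexx orbT.
  have d1 : d <= 1 by rewrite ge_min lexx.
  near=> y.
  have hB : `|B (f x) - B (f y)| <= d by near: y; exact: cvgr_dist_le.
  have hf : `|f x - f y| <= d by near: y; apply: cvgr_dist_le => //; exact: fc.
  have hg : `|g x - g y| <= d by near: y; apply: cvgr_dist_le => //; exact: gc.
  have -> : B (f x) (g x) - B (f y) (g y) = (B (f x) - B (f y)) (g x) + B (f y) (g x - g y).
    by rewrite linearB /= addrA scaleN1r subrK.
  rewrite (le_trans (ler_normD _ _))//.
  have h1 := le_trans (op_bound (B (f x) - B (f y)) (g x)) (ler_wpM2r (normr_ge0 _) hB).
  have fy : `|f y| <= `|f x| + 1.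
    have -> : f y = f x - (f x - f y) by rewrite opprB addrC subrK.
    by rewrite (le_trans (ler_normB _ _))// lerD2l (le_trans hf).
  have h2 : `|B (f y) (g x - g y)| <= `|B| * (`|f x| + 1) * d.
    rewrite (le_trans (bil_bound _ _ _))// ler_pM ?mulr_ge0//.
    by rewrite ler_wpM2l.
  rewrite (le_trans (lerD h1 h2))//; lra.
move=> fk1 gk1; have fk := CkS_Ck fk1; have gk := CkS_Ck gk1.
move: fk1 gk1 => /CkSP[Df fDf Dfk] /CkSP[Dg gDg Dgk]; apply/CkSP.
exists (fun x => bil_comp_left E B (Df x) (g x) + bil_comp_right E B (f x) (Dg x)).
  by move=> x Ux; apply: frechet_bil; [exact: fDf|exact: gDg].
by apply: CkD; exact: IH.
Unshelve. all: by end_near. Qed.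

End Smooth.

(** * Composition, pairs, and inversion of operators in class C^k *)

Section SmoothComp.
Context (R : realType).
Implicit Types (E F G H : normedModType R).

(** The derivative pairs Dg o f with Df under composition of operators. The induction is needed for
    Dg o f alone, so only the codomain of g is generalized. *)
Lemma Ck_comp E F G (U : set E) (V : set F) k (f : E -> F) (g : F -> G) :
  (forall x, U x -> V (f x)) -> Ck k U f -> Ck k V g -> Ck k U (fun x => g (f x)).
Proof.
move=> UV; elim: k G g => [|k IH] G g.
  move=> fc gc x Ux; apply: (@continuous_comp _ _ _ f g); first exact: fc.
  by apply: gc; exact: UV.
move=> fk1; have fk := CkS_Ck fk1.
move: fk1 => /CkSP[Df fDf Dfk] /CkSP[Dg gDg Dgk]; apply/CkSP.
exists (fun x => comp_bil E F G (Dg (f x)) (Df x)).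
  by move=> x Ux; apply: frechet_comp; [exact: fDf|apply: gDg; exact: UV].
by apply: Ck_bil => //; exact: IH.
Qed.

Section Product.
Context (F G : normedModType R).

Fact fst_op_linear : linear (fst : F * G -> F). Proof. by []. Qed.
Fact fst_op_bound (x : F * G) : `|x.1| <= 1 * `|x|.
Proof. by rewrite mul1r prod_normE le_max lexx. Qed.
Definition fst_op : bounded_op (F * G)%type F := mkop fst_op_linear fst_op_bound.

Fact snd_op_linear : linear (snd : F * G -> G). Proof. by []. Qed.
Fact snd_op_bound (x : F * G) : `|x.2| <= 1 * `|x|.
Proof. by rewrite mul1r prod_normE le_max lexx orbT. Qed.
Definition snd_op : bounded_op (F * G)%type G := mkop snd_op_linear snd_op_bound.

Fact inl_op_linear : linear (fun x : F => (x, 0 : G)).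
Proof. by move=> c x y; congr pair; rewrite /= scaler0 addr0. Qed.
Fact inl_op_bound (x : F) : `|(x, 0 : G)| <= 1 * `|x|.
Proof. by rewrite mul1r prod_normE /= normr0 ge_max lexx normr_ge0. Qed.
Definition inl_op : bounded_op F (F * G)%type := mkop inl_op_linear inl_op_bound.

Fact inr_op_linear : linear (fun x : G => (0 : F, x)).
Proof. by move=> c x y; congr pair; rewrite /= scaler0 addr0. Qed.
Fact inr_op_bound (x : G) : `|(0 : F, x)| <= 1 * `|x|.
Proof. by rewrite mul1r prod_normE /= normr0 ge_max lexx normr_ge0. Qed.
Definition inr_op : bounded_op G (F * G)%type := mkop inr_op_linear inr_op_bound.

End Product.

Lemma Ck_opcomp E F G (U : set E) k (L : bounded_op F G) (f : E -> F) :
  Ck k U f -> Ck k U (fun x => L (f x)).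
Proof. by move=> fk; apply: (@Ck_comp _ _ _ U setT) => //; exact: Ck_op. Qed.

Lemma Ck_pair E F G (U : set E) k (f : E -> F) (g : E -> G) :
  Ck k U f -> Ck k U g -> Ck k U (fun x => (f x, g x)).
Proof.
move=> fk gk.
have -> : (fun x => (f x, g x)) = (fun x => inl_op F G (f x) + inr_op F G (g x)).
  by apply/funext => x; congr pair; rewrite /= ?addr0 ?add0r.
by apply: CkD; exact: Ck_opcomp.
Qed.

Lemma Ck_id E (U : set E) k : Ck k U (fun x : E => x).
Proof.
have il : linear (fun x : E => x) by [].
have ib (x : E) : `|x| <= 1 * `|x| by rewrite mul1r.
exact: (Ck_op _ _ (mkop il ib)).
Qed.

Lemma open_near E (U : set E) x : open U -> U x -> \forall y \near x, U y.
Proof. by move=> oU Ux; exact: open_nbhs_nbhs. Qed.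

Fact opp_op_linear E : linear (fun x : E => - x).
Proof. by move=> c x y; rewrite opprD scalerN. Qed.
Fact opp_op_bound E (x : E) : `|- x| <= 1 * `|x|.
Proof. by rewrite mul1r normrN. Qed.

Lemma CkN E F (U : set E) k (f : E -> F) : Ck k U f -> Ck k U (fun x => - f x).
Proof. exact: (Ck_opcomp (mkop (@opp_op_linear F) (@opp_op_bound F))). Qed.

Lemma CkB E F (U : set E) k (f g : E -> F) :
  Ck k U f -> Ck k U g -> Ck k U (fun x => f x - g x).
Proof. by move=> fk gk; apply: CkD => //; exact: CkN. Qed.

(* The derivative of S = T^-1 is h |-> - S (DT h) S. *)
Lemma Ck_opinv E F G (U : set E) k (T : E -> bounded_op F G) (S : E -> bounded_op G F) :
  open U -> (forall x, U x -> forall y, S x (T x y) = y) ->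
  (forall x, U x -> forall z, T x (S x z) = z) ->
  Ck k U T -> Ck k U S.
Proof.
move=> oU ST TS.
have SB x y : U x -> U y -> S y - S x = - comp_op (S x) (comp_op (T y - T x) (S y)).
  move=> Ux Uy; apply: bounded_op_eq => z /=.
  by rewrite TS// !scaleN1r linearB /= ST// opprB.
have Sc : Ck 0 U T -> Ck 0 U S.
  move=> Tc x Ux; apply/cvgrPdist_le => e e0.
  (* The first bound gives |S y| <= 2 |S x|, the second then 2 |S x|^2 d <= e. *)
  pose d := Num.min (2 * (`|S x| + 1))^-1 (e / (2 * `|S x| ^+ 2 + 1)).
  have K0 : 0 < 2 * `|S x| ^+ 2 + 1 by rewrite ltr_wpDl// mulr_ge0.
  have d0 : 0 < d.
    by rewrite lt_min divr_gt0// invr_gt0 mulr_gt0// ltr_wpDl.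
  have d1 : d * (2 * (`|S x| + 1)) <= 1.
    by rewrite -ler_pdivlMr ?mulr_gt0// ?ltr_wpDl// div1r ge_min lexx.
  have d2 : d * (2 * `|S x| ^+ 2 + 1) <= e by rewrite -ler_pdivlMr// ge_min lexx orbT.
  near=> y.
  have Uy : U y by near: y; exact: open_near.
  have hT : `|T y - T x| <= d.
    by rewrite distrC; near: y; apply: cvgr_dist_le => //; exact: Tc.
  have hS : `|S y - S x| <= `|S x| * (`|T y - T x| * `|S y|).
    rewrite SB// normrN (le_trans (comp_op_norm _ _))// ler_wpM2l//.
    exact: comp_op_norm.
  have hSy : `|S y| <= `|S y - S x| + `|S x|.
    by rewrite -{1}[S y](subrK (S x)) ler_normD.
  have s0 := normr_ge0 (S x); have sy0 := normr_ge0 (S y).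
  have hP : `|S x| * (`|T y - T x| * `|S y|) <= `|S x| * (d * `|S y|).
    by rewrite ler_wpM2l// ler_wpM2r.
  have db := mulr_ge0 (ltW d0) sy0.
  have sy2 : `|S y| <= 2 * `|S x| by have := ler_wpM2r sy0 d1; lra.
  rewrite distrC; have := ler_wpM2l (mulr_ge0 s0 (ltW d0)) sy2.
  by move: d2 (ltW d0); rewrite expr2; lra.
(* S occurs in its own derivative, so S of class C^k and DT of class C^k give S of class C^(k+1). *)
elim: k => [//|k IH] Tk1; have Sk := IH (CkS_Ck Tk1).
have S0 : Ck 0 U S.
  by apply: Sc; elim: {IH Sk} k Tk1 => [|k IH] /CkS_Ck.
move: Tk1 => /CkSP[DT TDT DTk]; apply/CkSP.
pose D x := - bil_comp_right E (comp_bil G G F) (S x)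
    (bil_comp_left E (comp_bil G F G) (DT x) (S x)).
exists D; last first.
  by apply: CkN; apply: Ck_bil => //; exact: Ck_bil.
move=> x Ux e e0.
have DE h z : D x h z = - S x (DT x h (S x z)) by rewrite /D /= !scaleN1r.
pose K := `|S x| * (`|DT x| + 1) + `|S x| ^+ 2 + 1.
have K0 : 0 < K by rewrite ltr_wpDl// addr_ge0// mulr_ge0// addr_ge0.
pose d := Num.min 1 (e / K).
have d0 : 0 < d by rewrite lt_min ltr01 divr_gt0.
have d1 : d <= 1 by rewrite ge_min lexx.
have dK : d * K <= e by rewrite -ler_pdivlMr// ge_min lexx orbT.
near=> y.
have Uy : U y by near: y; exact: open_near.
have hT : `|T y - T x - DT x (y - x)| <= d * `|y - x| by near: y; exact: TDT.
have hS : `|S y - S x| <= d.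
  by rewrite distrC; near: y; apply: cvgr_dist_le => //; exact: S0.
have hTT : `|T y - T x| <= (`|DT x| + 1) * `|y - x|.
  rewrite -[T y - T x](subrK (DT x (y - x))) (le_trans (ler_normD _ _))//.
  rewrite addrC mulrDl lerD ?op_bound//.
  by rewrite (le_trans hT)// ler_wpM2r.
(* X is the second-order term from replacing S y by S x, and Y the first-order error of T seen
   through S x. *)
pose X := comp_op (S x) (comp_op (T y - T x) (S y - S x)).
pose Y := comp_op (S x) (comp_op (T y - T x - DT x (y - x)) (S x)).
have -> : S y - S x - D x (y - x) = - X - Y.
  apply: bounded_op_eq => z; rewrite op_subE DE opprK SB// op_oppE op_subE op_oppE.
  have -> : X z = S x ((T y - T x) (S y z)) - S x ((T y - T x) (S x z)).
    rewrite -linearB -linearB -op_subE //.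
  have -> : Y z = S x ((T y - T x) (S x z)) - S x (DT x (y - x) (S x z)).
    rewrite -linearB -op_subE //.
  by rewrite !opprB [RHS]addrC addrA subrK addrC.
rewrite (le_trans (ler_normB _ _))// normrN.
have hX : `|X| <= `|S x| * ((`|DT x| + 1) * `|y - x| * d).
  rewrite (le_trans (comp_op_norm _ _))// ler_wpM2l//.
  by rewrite (le_trans (comp_op_norm _ _))// ler_pM.
have hY : `|Y| <= `|S x| * (d * `|y - x| * `|S x|).
  rewrite (le_trans (comp_op_norm _ _))// ler_wpM2l//.
  by rewrite (le_trans (comp_op_norm _ _))// ler_wpM2r.
rewrite (le_trans (lerD hX hY))// (@le_trans _ _ (d * K * `|y - x|))//.
  by rewrite /K expr2; have := mulr_ge0 (ltW d0) (normr_ge0 (y - x)); lra.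
by rewrite ler_wpM2r.
Unshelve. all: by end_near. Qed.

End SmoothComp.

(** * Smooth operations on the real Banach space of a C*-algebra *)

(** A slice chart takes values in complete normed spaces, so the closed real subspace of
    self-adjoint elements is made into a type of its own. *)
Record sa_space (R : realType) (A : cstarAlgType R) := SelfAdjoint {
  sa_val :> realified A ;
  sa_valP : star (sa_val : A) = sa_val }.

Section SelfAdjointSpace.
Context (R : realType) (A : cstarAlgType R).
Local Notation S := (sa_space A).

Lemma sa_eq (x y : S) : sa_val x = sa_val y -> x = y.
Proof.
case: x y => [x xP] [y yP] /= xy; subst y.
by congr SelfAdjoint; exact: Prop_irrelevance.
Qed.

HB.instance Definition _ := gen_eqMixin S.
HB.instance Definition _ := gen_choiceMixin S.

Definition sa_zero : S := SelfAdjoint (star0 A).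

Fact sa_add_subproof (x y : S) : star ((sa_val x : A) + (sa_val y : A)) = (sa_val x : A) + (sa_val y : A).
Proof. by rewrite starD !sa_valP. Qed.
Definition sa_add (x y : S) : S := @SelfAdjoint R A _ (sa_add_subproof x y).

Fact sa_scale_subproof (c : R) (x : S) : star (c%:C *: (sa_val x : A)) = c%:C *: (sa_val x : A).
Proof. by rewrite starZr sa_valP. Qed.
Definition sa_scale (c : R) (x : S) : S := @SelfAdjoint R A _ (sa_scale_subproof c x).

Definition sa_opp (x : S) : S := sa_scale (-1) x.

Fact sa_addA : associative sa_add.
Proof. by move=> x y z; apply: sa_eq; rewrite /= addrA. Qed.
Fact sa_addC : commutative sa_add.
Proof. by move=> x y; apply: sa_eq; rewrite /= addrC. Qed.
Fact sa_add0 : left_id sa_zero sa_add.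
Proof. by move=> x; apply: sa_eq; rewrite /= add0r. Qed.
Fact sa_addN : left_inverse sa_zero sa_opp sa_add.
Proof. by move=> x; apply: sa_eq; rewrite /= rmorphN rmorph1 scaleN1r addNr. Qed.

HB.instance Definition _ :=
  GRing.isZmodule.Build S sa_addA sa_addC sa_add0 sa_addN.

Fact sa_scaleA a b (x : S) : sa_scale a (sa_scale b x) = sa_scale (a * b) x.
Proof. by apply: sa_eq; rewrite /= scalerA rmorphM. Qed.
Fact sa_scale1 : left_id 1 sa_scale.
Proof. by move=> x; apply: sa_eq; rewrite /= rmorph1 scale1r. Qed.
Fact sa_scaleDr : right_distributive sa_scale +%R.
Proof. by move=> a x y; apply: sa_eq; rewrite /= scalerDr. Qed.
Fact sa_scaleDl (x : S) : {morph sa_scale^~ x : a b / a + b}.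
Proof. by move=> a b; apply: sa_eq; rewrite /= rmorphD scalerDl. Qed.

HB.instance Definition _ := GRing.Zmodule_isLmodule.Build R S
  sa_scaleA sa_scale1 sa_scaleDr sa_scaleDl.

Definition sa_norm (x : S) : R := cnorm (sa_val x : A).

Fact sa_normD x y : sa_norm (x + y) <= sa_norm x + sa_norm y.
Proof. exact: (@cnormD _ A). Qed.
Fact sa_normZ (c : R) x : sa_norm (c *: x) = `|c| * sa_norm x.
Proof. exact: (@cnormZr _ A). Qed.
Fact sa_norm0_eq0 x : sa_norm x = 0 -> x = 0.
Proof. by move=> x0; apply: sa_eq; exact: (@cnorm0_eq0 _ A). Qed.

HB.instance Definition _ := @Lmodule_isNormed.Build R S
  sa_norm sa_normD sa_normZ sa_norm0_eq0.

Lemma sa_valB (x y : S) : sa_val (x - y) = sa_val x - sa_val y.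
Proof. by rewrite /= rmorphN rmorph1 scaleN1r. Qed.

Lemma sa_normE (x : S) : `|x| = `|sa_val x|.
Proof. by []. Qed.

Fact sa_complete (F : set_system S) : ProperFilter F -> cauchy F -> cvg F.
Proof.
move=> FF /cauchyP Fc.
have c1 : cauchy (@sa_val R A @ F).
  apply/cauchyP => e /Fc[x Fx]; exists (sa_val x).
  change (F (@sa_val R A @^-1` ball (sa_val x) e)).
  apply: filterS Fx => y; rewrite -!ball_normE /ball_ /=.
  by rewrite sa_normE sa_valB.
have [l /cvgrPdist_lt Fl] := (cvg_ex (@sa_val R A @ F)).1 (cauchy_cvg _ c1).
have sl : star (l : A) = l.
  apply/eqP; rewrite -subr_eq0; apply/eqP/cnorm_le_eq0 => e e0.
  have [y /= ly] := filter_ex (Fl _ (divr_gt0 e0 (ltr0n R 2))).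
  have ly' : cnorm ((l : A) - (sa_val y : A)) < e / 2 := ly.
  have -> : star (l : A) - l = star ((l : A) - (sa_val y : A)) - ((l : A) - (sa_val y : A)).
    by rewrite starB sa_valP; nring.
  by rewrite (le_trans (cnormB _ _))// cnorm_star; lra.
apply/cvg_ex; exists (SelfAdjoint sl); apply/cvgrPdist_lt => e e0.
have := Fl e e0; apply: filterS => y /=.
by rewrite sa_normE sa_valB.
Qed.

HB.instance Definition _ := Uniform_isComplete.Build S sa_complete.

End SelfAdjointSpace.

(** * Multiplication, involution and inversion on [realified A] *)

Section RealOperators.
Context (R : realType) (A : cstarAlgType R).
Local Notation X := (realified A).
Implicit Types (x y : X).

Lemma real_scaleE (c : R) x : c *: x = c%:C *: (x : A) :> A.
Proof. by []. Qed.

Lemma real_normE x : `|x| = cnorm (x : A).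
Proof. by []. Qed.

Definition real_mul x y : X := (x : A) * (y : A).

Fact real_mul_linearl y : linear (real_mul^~ y).
Proof.
move=> c x x'; rewrite /real_mul [LHS](@mulrDl A); congr (_ + _).
by rewrite !real_scaleE -scalerAl.
Qed.
Fact real_mul_linearr x : linear (real_mul x).
Proof.
move=> c y y'; rewrite /real_mul [LHS](@mulrDr A); congr (_ + _).
by rewrite !real_scaleE -scalerAr.
Qed.
Fact real_mul_bound x y : `|real_mul x y| <= 1 * `|x| * `|y|.
Proof. by rewrite mul1r; exact: (@cnormM _ A). Qed.

Definition mul_op : bounded_op X (bounded_op X X) :=
  mkbil real_mul_linearl real_mul_linearr real_mul_bound.

Fact real_mul_boundC x y : `|real_mul y x| <= 1 * `|x| * `|y|.
Proof. by rewrite mul1r mulrC; exact: (@cnormM _ A). Qed.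

Definition rmul_op : bounded_op X (bounded_op X X) :=
  mkbil (B := fun x y => real_mul y x) real_mul_linearr real_mul_linearl real_mul_boundC.

Definition real_star x : X := star (x : A).
Fact real_star_linear : linear real_star.
Proof. by move=> c x y; rewrite /real_star starD real_scaleE starZr. Qed.
Fact real_star_bound x : `|real_star x| <= 1 * `|x|.
Proof. by rewrite mul1r real_normE cnorm_star. Qed.
Definition star_op : bounded_op X X := mkop real_star_linear real_star_bound.

Definition real_i x : X := ('i : R[i]) *: (x : A).
Fact real_i_linear : linear real_i.
Proof. by move=> c x y; rewrite /real_i scalerDr real_scaleE !scalerA mulrC -scalerA. Qed.
Fact real_i_bound x : `|real_i x| <= 1 * `|x|.
Proof. by rewrite mul1r real_normE cnormZi. Qed.
Definition i_op : bounded_op X X := mkop real_i_linear real_i_bound.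

Fact re_part_subproof x :
  star ((2^-1 : R)%:C *: ((x : A) + star (x : A))) = (2^-1 : R)%:C *: ((x : A) + star (x : A)).
Proof. by rewrite starZr starD starK addrC. Qed.
Definition re_part x : sa_space A := @SelfAdjoint R A _ (re_part_subproof x).
Fact re_part_linear : linear re_part.
Proof.
move=> c x y; apply: sa_eq => /=.
rewrite [in LHS]starD [in LHS]real_scaleE [in LHS]starZr.
have e (p q : A) : (2^-1 : R)%:C *: (c%:C *: p + q + (c%:C *: star p + star q)) =
    c%:C *: ((2^-1 : R)%:C *: (p + star p)) + (2^-1 : R)%:C *: (q + star q).
  by rewrite addrACA -scalerDr [LHS]scalerDr !scalerA mulrC.
exact: e.
Qed.
Fact re_part_bound x : `|re_part x| <= 1 * `|x|.
Proof.
rewrite mul1r -[`|re_part x|]/(cnorm ((2^-1 : R)%:C *: ((x : A) + star (x : A)))).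
rewrite cnormZr ger0_norm ?invr_ge0 ?ler0n// real_normE.
have := cnormD (x : A) (star (x : A)); rewrite cnorm_star; lra.
Qed.
Definition re_op : bounded_op X (sa_space A) := mkop re_part_linear re_part_bound.

Lemma re_part_sa x : star (x : A) = x -> sa_val (re_part x) = x.
Proof.
move=> sx; rewrite /= sx scalerDr -scalerDl -rmorphD -[2^-1]mul1r -splitr.
by rewrite rmorph1 scale1r.
Qed.

Fact sa_val_linear : linear (@sa_val R A).
Proof. by []. Qed.
Fact sa_val_bound (x : sa_space A) : `|sa_val x| <= 1 * `|x|.
Proof. by rewrite mul1r. Qed.
Definition sa_val_op : bounded_op (sa_space A) X := mkop sa_val_linear sa_val_bound.

Section Evaluation.
Context (E F : normedModType R) (v : E).
Fact eval_linear : linear (fun L : bounded_op E F => L v).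
Proof. by []. Qed.
Fact eval_bound (L : bounded_op E F) : `|L v| <= `|v| * `|L|.
Proof. by rewrite mulrC op_bound. Qed.
Definition eval_op : bounded_op (bounded_op E F) F := mkop eval_linear eval_bound.
End Evaluation.

Lemma Ck_mul (E : normedModType R) (U : set E) k (f g : E -> X) :
  Ck k U f -> Ck k U g -> Ck k U (fun t => real_mul (f t) (g t)).
Proof. exact: (Ck_bil mul_op). Qed.

Definition real_units : set X := [set x | (x : A) \is a GRing.unit].
Definition real_inv x : X := (x : A)^-1.

Lemma open_norm (P : set X) :
  (forall x, P x -> exists2 d : R, 0 < d & forall y, `|x - y| < d -> P y) -> open P.
Proof.
move=> h; rewrite openE => x Px; have [d d0 Pd] := h x Px.
by apply/nbhs_ballP; exists d => // y; rewrite -ball_normE => /Pd.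
Qed.

Lemma open_real_units : open real_units.
Proof.
apply: open_norm => x xu.
have K0 : 0 < 2 * (cnorm (x : A)^-1 + 1) by rewrite mulr_gt0// ltr_wpDl// cnorm_ge0.
exists (2 * (cnorm (x : A)^-1 + 1))^-1; first by rewrite invr_gt0.
move=> y; rewrite -[X in X < _]/(cnorm ((x : A) - (y : A))) => xy.
have -> : y = (x : A) - ((x : A) - (y : A)) :> A by nring.
apply: (cnormV_perturb xu _).1.
move: xy; rewrite -[X in _ < X]div1r ltr_pdivlMr//.
by have := cnorm_ge0 ((x : A) - (y : A)); have := cnorm_ge0 (x : A)^-1; nra.
Qed.

(** Left multiplication by x^-1 is the inverse operator of left multiplication by x; evaluation at 1
    recovers x^-1. *)
Lemma Ck_inv (E : normedModType R) (U : set E) k (f : E -> X) :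
  (forall t, U t -> real_units (f t)) -> Ck k U f -> Ck k U (fun t => real_inv (f t)).
Proof.
move=> fu fk; apply: (Ck_comp fu fk).
have Sk : Ck k real_units (fun x => mul_op (real_inv x)).
  apply: (@Ck_opinv _ _ _ _ real_units k mul_op); first exact: open_real_units.
  - by move=> x xu y; exact: (@mulKr A).
  - by move=> x xu y; exact: (@mulVKr A).
  - exact: Ck_op.
have := Ck_opcomp (eval_op X ((1 : A) : X)) Sk.
by congr Ck; apply/funext => x; exact: (@mulr1 A).
Qed.

End RealOperators.

(** * Smoothness of the square root *)

Section SquareRoot.
Context (R : realType) (A : cstarAlgType R).
Local Notation X := (realified A).
Implicit Types (a b c x y : A).

(* An open neighbourhood in A of the positive invertible elements. *)
Definition sqrt_dom : set A := [set a | exists2 t : R, 0 < t & cnorm (t%:C%:A - a) < t].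

Lemma sqrt_dom_unit a : sqrt_dom a -> a \is a GRing.unit.
Proof.
move=> [t t0 at_]; have -> : a = t%:C%:A - (t%:C%:A - a) by nring.
by apply: unit_sub_scalar; rewrite Re_norm_real gtr0_norm.
Qed.

Lemma sqrt_dom_star a : sqrt_dom a -> sqrt_dom (star a).
Proof.
move=> [t t0 at_]; exists t => //.
by rewrite -(sa_scalar A) -starB cnorm_star.
Qed.

(** An invertible positive a has no spectrum in [0, e), by perturbation from 0. Hence a - e is still
    positive, and its norm criterion at t becomes strict for a at t + e. *)
Lemma sqrt_domP a : star a = a ->
  sqrt_dom a <-> positive a /\ a \is a GRing.unit.
Proof.
move=> sa; split=> [ad|[pa au]].
  split; last exact: sqrt_dom_unit.
  by case: ad => t _ /ltW; exact: positive_cnormB.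
pose e := (2 * (cnorm a^-1 + 1))^-1.
have K0 : 0 < 2 * (cnorm a^-1 + 1) by rewrite mulr_gt0// ltr_wpDl// cnorm_ge0.
have e0 : 0 < e by rewrite invr_gt0.
have eK : e * (2 * (cnorm a^-1 + 1)) = 1 by rewrite mulVf// gt_eqF.
have pe : positive (a - e%:C%:A).
  split; first by rewrite starB sa sa_scalar.
  move=> z; rewrite /spectrum /= -addrA -opprD -scalerDl => zn.
  have := pa.2 _ zn; case: z zn => p q zn; rewrite lecE /= add0r => /andP[q0 ep].
  rewrite lecE /= q0 /= leNgt; apply/negP => p0.
  move: zn; apply/negP; rewrite negbK; move: q0 => /eqP ->.
  rewrite [X in X%:A](_ : _ = (e + p)%:C); last first.
    by apply/eqP; rewrite eq_complex /= addr0 !eqxx.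
  apply: (cnormV_perturb au _).1.
  rewrite cnorm_scalar ger0_norm//; have := cnorm_ge0 a^-1; nra.
pose t := cnorm (a - e%:C%:A).
exists (t + e); first by rewrite ltr_wpDl// cnorm_ge0.
have -> : (t + e)%:C%:A - a = t%:C%:A - (a - e%:C%:A).
  by rewrite rmorphD scalerDl; nring.
by rewrite (le_lt_trans (cnormB_positive pe (lexx _)))// ltrDl.
Qed.

Lemma sqrt_exists a : sqrt_dom a -> exists2 b, sqrt_dom b & b * b = a.
Proof.
move=> [t t0 at_]; pose w := 1 - (t^-1)%:C *: a.
have tw : t%:C *: w = t%:C%:A - a.
  by rewrite /w scalerBr scalerA -rmorphM divff ?gt_eqF// rmorph1 scale1r.
have w1 : cnorm w < 1 by rewrite -(ltr_pM2l t0) mulr1 -{1}(gtr0_norm t0) -cnormZr tw.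
have [u [uw u2 _ _]] := sqrt_1sub (ltW w1).
exists ((Num.sqrt t)%:C *: (1 - u)).
  exists (Num.sqrt t); first by rewrite sqrtr_gt0.
  rewrite -scalerBr opprB addrC subrK cnormZr ger0_norm ?sqrtr_ge0//.
  by rewrite gtr_pMr ?sqrtr_gt0// (le_lt_trans uw).
rewrite -scalerAl -scalerAr u2 scalerA -rmorphM -expr2 sqr_sqrtr ?ltW//.
by rewrite scalerBr tw opprB addrC subrK.
Qed.

(** Compare with (s + t) x = (b x + x c) + (s - b) x + x (t - c). Distinct b and c are allowed so
    that two different roots can be compared. *)
Lemma sylvester_bound b c (s t : R) x : 0 <= s -> 0 <= t ->
  (s - cnorm (s%:C%:A - b) + (t - cnorm (t%:C%:A - c))) * cnorm x <=
  cnorm (b * x + x * c).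
Proof.
move=> s0 t0.
have E : (s + t)%:C *: x = (b * x + x * c) + (s%:C%:A - b) * x + x * (t%:C%:A - c).
  by rewrite rmorphD scalerDl mulrBl mulrBr mulr_algl mulr_algr; nring.
have := cnormD (b * x + x * c + (s%:C%:A - b) * x) (x * (t%:C%:A - c)).
have := cnormD (b * x + x * c) ((s%:C%:A - b) * x).
rewrite -E cnormZr ger0_norm ?addr_ge0//.
have := cnormM (s%:C%:A - b) x; have := cnormM x (t%:C%:A - c); lra.
Qed.

Lemma sylvester_inj b c x : sqrt_dom b -> sqrt_dom c -> b * x + x * c = 0 -> x = 0.
Proof.
move=> [s s0 bs] [t t0 ct] bc; have := sylvester_bound b c x (ltW s0) (ltW t0).
rewrite bc cnorm0 pmulr_rle0; last by lra.
by move=> x0; apply/eqP; rewrite -cnorm_eq0 eq_le x0 cnorm_ge0.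
Qed.

(** Here b x + x b = 2 s (x - T x), where T contracts with ratio |s - b| / s. *)
Lemma sylvester_solve b y : sqrt_dom b -> exists x, b * x + x * b = y.
Proof.
move=> [s s0 bs]; pose q := cnorm (s%:C%:A - b) / s.
pose r : R := (2 * s)^-1.
have r0 : 0 < r by rewrite invr_gt0 mulr_gt0.
have rs : r * (2 * s) = 1 by rewrite mulVf// gt_eqF// mulr_gt0.
pose T x := r%:C *: ((s%:C%:A - b) * x + x * (s%:C%:A - b)).
have [| | |x|x xE] := @contraction_solve _ _ T q (r%:C *: y).
- by rewrite divr_ge0 ?cnorm_ge0// ltW.
- by rewrite ltr_pdivrMr// mul1r.
- by move=> u v; rewrite /T -scalerBr; congr (_ *: _); nring.
- rewrite /T cnormZr gtr0_norm//.
  have -> : q = r * (2 * cnorm (s%:C%:A - b)) by rewrite /q /r; field; rewrite gt_eqF.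
  rewrite -mulrA; apply: ler_wpM2l; first exact: ltW.
  have := cnormD ((s%:C%:A - b) * x) (x * (s%:C%:A - b)).
  have := cnormM (s%:C%:A - b) x; have := cnormM x (s%:C%:A - b); lra.
exists x; have r1 : r%:C != 0 :> R[i] by rewrite fmorph_eq0 gt_eqF.
apply: (scalerI r1); rewrite -xE.
have xr : r%:C *: ((2 * s)%:C *: x) = x.
  by rewrite scalerA -rmorphM rs rmorph1 scale1r.
transitivity (r%:C *: ((2 * s)%:C *: x) - T x); last by rewrite xr.
rewrite /T -scalerBr; congr (_ *: _).
rewrite mulrBl mulrBr mulr_algl mulr_algr -[2]/(1 + 1) mulrDl mul1r rmorphD scalerDl.
nring.
Qed.

(** The difference solves b (b - c) + (b - c) c = b^2 - c^2 = 0. *)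
Lemma sqrt_unique b c : sqrt_dom b -> sqrt_dom c -> b * b = c * c -> b = c.
Proof.
move=> bd cd bc; apply/eqP; rewrite -subr_eq0; apply/eqP.
apply: (sylvester_inj bd cd).
by rewrite mulrBr mulrBl bc; nring.
Qed.

Definition csqrt a : A := xget 0 [set b | sqrt_dom b /\ b * b = a].

Lemma csqrtP a : sqrt_dom a -> sqrt_dom (csqrt a) /\ csqrt a * csqrt a = a.
Proof.
by move=> /sqrt_exists[b bd b2]; apply: (@xgetPex _ 0 [set b | sqrt_dom b /\ b * b = a]); exists b.
Qed.

Lemma csqrt_sa a : sqrt_dom a -> star a = a -> star (csqrt a) = csqrt a.
Proof.
move=> /csqrtP[bd b2] sa; apply: sqrt_unique => //; first exact: sqrt_dom_star.
by rewrite -starM b2 sa.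
Qed.

Definition sylvester_op (b : X) : bounded_op X X := (mul_op A + rmul_op A) b.

Lemma sylvester_inverse (b : X) : sqrt_dom b -> exists Q : bounded_op X X,
  (forall x, Q (sylvester_op b x) = x) /\ (forall y, sylvester_op b (Q y) = y).
Proof.
move=> bd; have /choice[Q QE] := fun y => @sylvester_solve b y bd.
have inj x y : (b : A) * x + x * b = b * y + y * b -> x = y.
  move=> xy; apply/eqP; rewrite -subr_eq0; apply/eqP; apply: (sylvester_inj bd bd).
  rewrite mulrBr mulrBl addrACA -opprD; apply/eqP; rewrite subr_eq0; exact/eqP.
have Ql : linear (Q : X -> X).
  move=> k x y; apply: inj; rewrite QE.
  have QE' z : z = sylvester_op b (Q z) by rewrite -[LHS](QE z).
  by rewrite {1}(QE' x) {1}(QE' y) -linearP.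
have [s s0 bs] := bd; pose K := 2 * (s - cnorm (s%:C%:A - (b : A))).
have K0 : 0 < K by rewrite mulr_gt0// subr_gt0.
have Qb (x : X) : `|(Q x : X)| <= K^-1 * `|x|.
  rewrite ler_pdivlMl// /K mulr2n mulrDl !mul1r.
  by have := sylvester_bound b b (Q x) (ltW s0) (ltW s0); rewrite QE.
exists (mkop Ql Qb); split=> [x|y]; last exact: QE.
by apply: inj; rewrite QE.
Qed.

Lemma open_sqrt_dom : open (sqrt_dom : set X).
Proof.
apply: open_norm => x [t t0 xt]; exists (t - cnorm (t%:C%:A - (x : A))).
  by rewrite subr_gt0.
move=> y; rewrite real_normE => xy; exists t => //.
have -> : t%:C%:A - (y : A) = (t%:C%:A - (x : A)) + ((x : A) - (y : A)) by nring.
rewrite (le_lt_trans (cnormD _ _))//.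
by rewrite -ltrBrDl.
Qed.

(** With b' the root of a', b (b' - b) + (b' - b) b' = a' - a. The contribution of b' to the
    Sylvester bound is positive and is dropped, so K depends on a only. *)
Lemma csqrt_lipschitz (a : X) : sqrt_dom a -> exists2 K : R, 0 < K &
  forall a' : X, sqrt_dom a' -> `|(csqrt a' : X) - csqrt a| <= K * `|a' - a|.
Proof.
move=> ad; have [bd b2] := csqrtP ad; have [s s0 bs] := bd.
set b := csqrt a in bd b2 bs *.
have k0 : 0 < s - cnorm (s%:C%:A - b) by rewrite subr_gt0.
exists (s - cnorm (s%:C%:A - b))^-1; first by rewrite invr_gt0.
move=> a' /csqrtP[b'd b'2]; have [t t0 b't] := b'd.
set b' := csqrt a' in b'd b'2 b't *.
rewrite ler_pdivlMl//.
have := sylvester_bound b b' (b' - b) (ltW s0) (ltW t0).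
have -> : b * (b' - b) + (b' - b) * b' = (a' : A) - (a : A) by rewrite -b2 -b'2; nring.
apply: le_trans; rewrite ler_wpM2r ?cnorm_ge0// lerDl subr_ge0 ltW//.
Qed.

(** With x the increment of the root, y - a = b x + x b + x^2. Applying Q leaves the error - Q
    (x^2), quadratic in y - a by the Lipschitz bound. *)
Lemma frechet_csqrt (a : X) (Q : bounded_op X X) : sqrt_dom a ->
  (forall x, Q (sylvester_op (csqrt a) x) = x) ->
  frechet (csqrt : X -> X) a Q.
Proof.
move=> ad QE e e0; have [K K0 cK] := csqrt_lipschitz ad.
pose M := `|Q| * K ^+ 2 + 1.
have M0 : 0 < M by rewrite ltr_wpDl// mulr_ge0// sqr_ge0.
near=> y.
have yd : sqrt_dom y by near: y; exact: (open_near open_sqrt_dom).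
have ya : `|y - a| <= e / M.
  near: y; under eq_near do rewrite distrC.
  by apply: cvgr_dist_le; [exact: cvg_id|exact: divr_gt0].
pose x : X := (csqrt y : X) - csqrt a.
have xK : `|x| <= K * `|y - a| by exact: cK.
have xE : y - a = sylvester_op (csqrt a) x + mul_op A x x.
  have [_ b2] := csqrtP ad; have [_ b'2] := csqrtP yd.
  have e2 (b b' : A) : b' * b' - b * b = (b * (b' - b) + (b' - b) * b) + (b' - b) * (b' - b).
    by nring.
  by rewrite -{1}b2 -{1}b'2; exact: e2.
have -> : (csqrt y : X) - csqrt a - Q (y - a) = - Q (mul_op A x x).
  by rewrite xE linearD /= QE opprD addrA -/x subrr sub0r.
rewrite normrN (le_trans (op_bound _ _))//.
have h1 : `|mul_op A x x| <= `|x| * `|x| by exact: (@cnormM _ A).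
have h2 : `|x| * `|x| <= (K * `|y - a|) * (K * `|y - a|) by rewrite ler_pM.
rewrite (le_trans (ler_wpM2l _ (le_trans h1 h2)))//.
have -> : `|Q| * (K * `|y - a| * (K * `|y - a|)) = (`|Q| * K ^+ 2 * `|y - a|) * `|y - a|.
  by ring.
rewrite ler_wpM2r//; move: ya; rewrite ler_pdivlMr// /M; have := normr_ge0 (y - a); lra.
Unshelve. all: by end_near. Qed.

(** Bootstrap: the derivative at a inverts the Sylvester operator of [csqrt a], which is of class
    C^k as soon as [csqrt] is. *)
Lemma Ck_csqrt k : Ck k (sqrt_dom : set X) (csqrt : X -> X).
Proof.
have /choice[Q QE] : forall b : X, exists Q : bounded_op X X, sqrt_dom b ->
    (forall x, Q (sylvester_op b x) = x) /\ (forall y, sylvester_op b (Q y) = y).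
  move=> b; have [/sylvester_inverse[Q QE]|nb] := pselect (sqrt_dom b); first by exists Q.
  by exists 0.
have fQ (a : X) : sqrt_dom a -> frechet (csqrt : X -> X) a (Q (csqrt a)).
  move=> ad; apply: frechet_csqrt => // x.
  by apply: (QE _ _).1; exact: (csqrtP ad).1.
elim: k => [|k IH]; first by move=> a /fQ/frechet_continuous.
apply/CkSP; exists (fun a : X => Q (csqrt a)) => //.
apply: (@Ck_opinv R X X X (sqrt_dom : set X) k (fun a : X => sylvester_op (csqrt a))).
- exact: open_sqrt_dom.
- by move=> a /csqrtP[bd _] y; exact: (QE _ bd).1.
- by move=> a /csqrtP[bd _] y; exact: (QE _ bd).2.
- exact: (Ck_opcomp (mul_op A + rmul_op A) IH).
Qed.

End SquareRoot.

(** * K_H as a submanifold *)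

Section Chart.
Context (R : realType) (A : cstarAlgType R).
Local Notation X := (realified A).
Local Notation X2 := (X * X)%type.
Local Notation S := (sa_space A).
Implicit Types (h : A).

Definition half_gram (x : X) : X := (2^-1 : R) *: real_mul (real_star (real_inv x)) (real_inv x).

Lemma half_gram_sa (x : X) : star (half_gram x : A) = half_gram x.
Proof. by rewrite /half_gram real_scaleE starZr starM starK. Qed.

Definition chart_dom : set X2 := [set x | real_units x.1].
Definition chart_cod : set ((X * S) * S) := [set y | real_units y.1.1].

(* With h = x_2 x_1^-1, the last component is Im h - (x_1 x_1^* )^-1 / 2. *)
Definition chart (x : X2) : (X * S) * S :=
  ((x.1, re_op A (real_mul x.2 (real_inv x.1))),
   re_op A (- i_op A (real_mul x.2 (real_inv x.1)) - half_gram x.1)).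

Definition chart_inv (y : (X * S) * S) : X2 :=
  (y.1.1, real_mul (sa_val y.1.2 + i_op A (sa_val y.2 + half_gram y.1.1)) y.1.1).

Lemma open_chart_dom : open chart_dom.
Proof.
have /continuousP : continuous (fst_op X X : X2 -> X) by exact: bounded_op_continuous.
by move=> /(_ _ (@open_real_units R A)).
Qed.

Lemma open_chart_cod : open chart_cod.
Proof.
have /continuousP : continuous (comp_op (fst_op X S) (fst_op (X * S)%type S) : _ -> X).
  exact: bounded_op_continuous.
by move=> /(_ _ (@open_real_units R A)).
Qed.

(** Cartesian decomposition, with Im h written as Re (- i h) as in [chart]. *)
Lemma re_decomposition h :
  (2^-1 : R)%:C *: (h + star h) + 'i *: ((2^-1 : R)%:C *: (- ('i *: h) + star (- ('i *: h)))) = h.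
Proof.
have -> : star (- (('i : R[i]) *: h)) = 'i *: star h.
  by rewrite starN starZ conjCi scaleNr opprK.
rewrite -scalerN -scalerDr ['i *: (_ *: _)]scalerA [_ * (2^-1)%:C]mulrC -!scalerA.
rewrite ['i *: (_ *: _)]scalerA [X in X *: (- h + _)](_ : _ = -1); last exact: mulCii.
rewrite -scalerDr scaleN1r opprD opprK addrACA subrr addr0.
by rewrite scalerDr -scalerDl -rmorphD -[2^-1]mul1r -splitr rmorph1 scale1r.
Qed.

Lemma chartK x : chart_dom x -> chart_inv (chart x) = x.
Proof.
case: x => x1 x2 xu; congr pair.
pose h : X := real_mul x2 (real_inv x1).
change (real_mul (sa_val (re_op A h) +
  i_op A (sa_val (re_op A (- i_op A h - half_gram x1)) + half_gram x1)) x1 = x2).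
have -> : sa_val (re_op A (- i_op A h - half_gram x1)) =
    sa_val (re_op A (- i_op A h)) - half_gram x1.
  by rewrite opB sa_valB (re_part_sa (half_gram_sa x1)).
rewrite subrK.
have := re_decomposition h.
rewrite -[LHS]/((sa_val (re_op A h) + i_op A (sa_val (re_op A (- i_op A h))) : X) : A).
by move=> ->; exact: (@mulrVK A).
Qed.

Lemma i_sa_re (r : X) : star (r : A) = r -> re_op A (i_op A r) = 0.
Proof.
move=> sr; apply: sa_eq; rewrite /= /real_i starZ conjCi sr scaleNr.
by rewrite [X in _ *: X](@subrr A) [LHS](@scaler0 _ A).
Qed.

Lemma chart_invK y : chart_cod y -> chart (chart_inv y) = y.
Proof.
case: y => -[x1 r] s xu; pose t := sa_val s + half_gram x1.
pose h := real_mul (real_mul (sa_val r + i_op A t) x1) (real_inv x1).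
transitivity ((x1, re_op A h), re_op A (- i_op A h - half_gram x1)); first by [].
have st : star (t : A) = t by rewrite /t starD sa_valP half_gram_sa.
have -> : h = sa_val r + i_op A t.
  exact: (@mulrK A).
have i2 (u : X) : i_op A (i_op A u) = - u.
  rewrite /= /real_i [LHS](@scalerA _ A) [X in X *: _](_ : _ = -1); last exact: mulCii.
  exact: (@scaleN1r _ A).
have re_sa (u : S) : re_op A (sa_val u) = u.
  by apply: sa_eq; apply: re_part_sa; exact: sa_valP.
congr (_, _, _).
  by rewrite opD re_sa i_sa_re// addr0.
rewrite (opD (i_op A)) i2 opprD opprK -addrA opD opN.
rewrite [re_op A (i_op A _)]i_sa_re ?sa_valP// oppr0 add0r.
by rewrite /t addrK re_sa.
Qed.

(** The last coordinate is half of (h - h^* ) / i - x_1^-* x_1^-1; multiplying by x_1^* on the left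
    and x_1 on the right turns its vanishing into the equation of [KH]. *)
Lemma chart_slice x : chart_dom x -> KH A x <-> (chart x).2 = 0.
Proof.
move=> xu; rewrite KHE; pose h : A := x.2 * x.1^-1.
have x1u : x.1 \is a GRing.unit by [].
pose G : A := star x.1^-1 * x.1^-1.
have hE : star x.1 * (h - star h) * x.1 = star x.1 * x.2 - star x.2 * x.1.
  have x1K : star x.1 * star x.1^-1 = 1 by rewrite -starM mulVr ?star1.
  rewrite [LHS](_ : _ = star x.1 * x.2 * (x.1^-1 * x.1) - star x.1 * star h * x.1); last first.
    by rewrite /h; nring.
  by rewrite mulVr// mulr1 /h starM [in LHS]mulrA x1K mul1r.
have GE : star x.1 * ('i *: G) * x.1 = ('i : R[i])%:A.
  have x1K : star x.1 * star x.1^-1 = 1 by rewrite -starM mulVr ?star1.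
  by rewrite -scalerAr -scalerAl /G mulrA x1K mul1r mulVr.
have vE : sa_val (chart x).2 = (2^-1 : R)%:C *: (('i : R[i])^-1 *: (h - star h) - G) :> A.
  have e (u : A) : - ('i *: u) - (2^-1 : R)%:C *: G + star (- ('i *: u) - (2^-1 : R)%:C *: G) =
     'i^-1 *: (u - star u) - G.
    have half : (2^-1 : R)%:C *: G + (2^-1 : R)%:C *: G = G.
      by rewrite -scalerDl -rmorphD -[2^-1]mul1r -splitr rmorph1 scale1r.
    rewrite starB starN starZ conjCi starZr [star G]starM starK -/G scaleNr opprK.
    by rewrite addrACA -opprD half invCi scaleNr scalerBr opprB [X in X - _ = _]addrC.
  by rewrite -e.
split=> [[e _]|/(congr1 (@sa_val R A)) e].
  apply: sa_eq; rewrite vE.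
  have -> : h - star h = 'i *: G.
    apply: (mulIr x1u); apply: (@mulrI _ (star x.1)); first by rewrite star_unit.
    by rewrite !mulrA hE e GE.
  by rewrite scalerA mulVf ?neq0Ci// scale1r subrr scaler0.
split=> //; rewrite -hE -GE; congr (_ * _ * _).
have r2 : (2^-1 : R)%:C != 0 :> R[i] by rewrite fmorph_eq0 invr_eq0 pnatr_eq0.
have /eqP : (2^-1 : R)%:C *: (('i : R[i])^-1 *: (h - star h) - G) = 0 by rewrite -vE e.
rewrite scaler_eq0 (negbTE r2) subr_eq0 => /eqP <-.
by rewrite scalerA divff ?neq0Ci// scale1r.
Qed.

Lemma Ck_half_gram (E : normedModType R) (U : set E) k (f : E -> X) :
  (forall t, U t -> real_units (f t)) -> Ck k U f -> Ck k U (fun t => half_gram (f t)).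
Proof.
move=> fu fk; have ik := Ck_inv fu fk.
have := Ck_mul (Ck_opcomp (star_op A) ik) ik.
have sl : linear (fun x : X => (2^-1 : R) *: x).
  by move=> c x y; rewrite scalerDr !scalerA mulrC.
have sb (x : X) : `|(2^-1 : R) *: x| <= 2^-1 * `|x|.
  by rewrite normrZ ger0_norm ?invr_ge0.
exact: (Ck_opcomp (mkop sl sb)).
Qed.

Lemma Cinf_chart : Cinf chart_dom chart.
Proof.
move=> k.
have f1 : Ck k chart_dom (fun x : X2 => x.1) := Ck_op _ _ (fst_op X X).
have f2 : Ck k chart_dom (fun x : X2 => x.2) := Ck_op _ _ (snd_op X X).
have hk : Ck k chart_dom (fun x : X2 => real_mul x.2 (real_inv x.1)).
  by apply: Ck_mul => //; exact: Ck_inv.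
apply: Ck_pair; first by apply: Ck_pair => //; exact: Ck_opcomp.
apply: Ck_opcomp; apply: CkB; last exact: Ck_half_gram.
by apply: CkN; exact: Ck_opcomp.
Qed.

Lemma Cinf_chart_inv : Cinf chart_cod chart_inv.
Proof.
move=> k.
have f0 : Ck k chart_cod (fun y : (X * S) * S => y.1) := Ck_op _ _ (fst_op _ _).
have f1 : Ck k chart_cod (fun y : (X * S) * S => y.1.1) := Ck_opcomp (fst_op X S) f0.
have f2 : Ck k chart_cod (fun y : (X * S) * S => y.1.2) := Ck_opcomp (snd_op X S) f0.
have f3 : Ck k chart_cod (fun y : (X * S) * S => y.2) := Ck_op _ _ (snd_op _ _).
apply: Ck_pair => //; apply: Ck_mul => //; apply: CkD.
  exact: (Ck_opcomp (sa_val_op A)).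
apply: Ck_opcomp; apply: CkD; last exact: Ck_half_gram.
exact: (Ck_opcomp (sa_val_op A)).
Qed.

Definition KH_chart : slice_chart (KH A : set X2) :=
  @SliceChart R (X * X)%type (KH A : set X2) (X * S)%type S chart_dom chart_cod
    chart chart_inv open_chart_dom open_chart_cod (fun x xd => xd) (fun y yd => yd)
    chartK chart_invK Cinf_chart Cinf_chart_inv chart_slice.

Lemma KH_submanifold : Cinf_submanifold (KH A : set X2).
Proof. by move=> x [_ xu]; exists KH_chart. Qed.

Lemma phi_Cinf : Cinf_from_submanifold (KH A : set X2) (phi (A := A) : X2 -> X).
Proof.
move=> x [_ xu]; exists KH_chart => // k.
have f1 : Ck k chart_dom (fun x : X2 => x.1) := Ck_op _ _ (fst_op X X).
have f2 : Ck k chart_dom (fun x : X2 => x.2) := Ck_op _ _ (snd_op X X).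
have hk : Ck k chart_dom (fun x : X2 => real_mul x.2 (real_inv x.1)).
  by apply: Ck_mul => //; exact: Ck_inv.
apply: (@Ck_comp _ _ _ _ _ chart_dom k _ (phi (A := A) : X2 -> X)) hk => //.
apply: (@Ck_comp _ _ _ _ _ chart_cod k _ chart_inv) (Cinf_chart_inv k) => //.
exact: (Ck_op _ _ (inl_op (X * S)%type S)).
Qed.

Definition q_op (h : X) : X := - i_op A (h - real_star h).

Definition KH_section (h : X) : X2 :=
  (real_inv (csqrt (q_op h)), real_mul h (real_inv (csqrt (q_op h)))).

Lemma q_opE h : q_op h = ('i : R[i])^-1 *: (h - star h) :> A.
Proof. by rewrite invCi scaleNr. Qed.

Lemma q_op_sa h : star (q_op h : A) = q_op h.
Proof.
have e (u : A) : star (- (('i : R[i]) *: (u - star u))) = - ('i *: (u - star u)).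
  by rewrite starN starZ conjCi scaleNr opprK starB starK -opprB scalerN.
exact: e.
Qed.

(** This exhibits the half-space as the preimage of the open set [sqrt_dom], which gives both its
    openness and the smoothness of the section. *)
Lemma upper_halfE h : upper_half A h <-> sqrt_dom (q_op h : A).
Proof.
rewrite (sqrt_domP (q_op_sa h)) /upper_half /= iV_sub_im_part -q_opE.
have r2 : (2^-1 : R)%:C != 0 :> R[i] by rewrite fmorph_eq0 invr_eq0 pnatr_eq0.
split=> -[]; rewrite /= ?unitZ//.
  move=> qu pq; split=> //.
  have -> : q_op h = (2 : R)%:C *: ((2^-1 : R)%:C *: (q_op h : A)) :> A.
    by rewrite scalerA -rmorphM divff ?pnatr_eq0// rmorph1 scale1r.
  by apply: positiveZ => //; rewrite ler0n.
by move=> pq qu; split=> //; rewrite ?unitZ//; apply: positiveZ; rewrite // invr_ge0 ler0n.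
Qed.

Lemma KH_sectionP h : upper_half A h -> KH A (KH_section h) /\ phi (KH_section h) = h.
Proof.
move=> /upper_halfE qd; have [bd b2] := csqrtP qd.
have bu := sqrt_dom_unit bd.
split; last by rewrite /phi /= [X in _ * X](@invrK A); exact: (@mulrVK A).
apply: section_KH => //; first exact: csqrt_sa (q_op_sa h).
by rewrite b2 q_opE.
Qed.

Lemma Ck_q_op (U : set X) k : Ck k U q_op.
Proof.
apply: CkN; apply: Ck_opcomp; apply: CkB; first exact: Ck_id.
exact: (Ck_op _ _ (star_op A)).
Qed.

Lemma upper_half_open : open (upper_half A : set X).
Proof.
have -> : (upper_half A : set X) = q_op @^-1` (@sqrt_dom R A : set X).
  by apply/seteqP; split=> h /upper_halfE.
apply: open_comp; last exact: open_sqrt_dom.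
by move=> x _; exact: (@Ck_q_op setT 0%N x).
Qed.

Lemma Ck_KH_section k : Ck k (upper_half A : set X) KH_section.
Proof.
have rk : Ck k (upper_half A : set X) (fun h : X => (csqrt (q_op h) : X)).
  apply: (@Ck_comp _ X X X _ (@sqrt_dom R A : set X) k q_op (@csqrt R A)).
  - by move=> h /upper_halfE.
  - exact: Ck_q_op.
  - exact: Ck_csqrt.
have ik : Ck k (upper_half A : set X) (fun h : X => real_inv (csqrt (q_op h))).
  by apply: Ck_inv rk => h /upper_halfE/csqrtP[bd _]; exact: sqrt_dom_unit.
by apply: Ck_pair => //; apply: Ck_mul => //; exact: Ck_id.
Qed.

Lemma KH_section_Cinf :
  Cinf_to_submanifold (upper_half A : set X) (KH A : set X2) KH_section.
Proof.
move=> h hH; exists (upper_half A), KH_chart; split => //.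
- exact: upper_half_open.
- by move=> w /KH_sectionP[Kw _]; split=> //; case: Kw.
- move=> k.
  have ck : Ck k (upper_half A : set X) (fun w => chart (KH_section w)).
    apply: (@Ck_comp _ X X2 _ _ chart_dom k KH_section chart).
    + by move=> w /KH_sectionP[[]].
    + exact: Ck_KH_section.
    + exact: Cinf_chart.
  exact: (Ck_opcomp (fst_op (X * S)%type S) ck).
Qed.

End Chart.

Theorem theorem6p5 (R : realType) (A : cstarAlgType R) :
  let A2 := (realified A * realified A)%type in
  (* (1) *)
  [/\ subgroup_of (Borel A) (UthetaH A),
      acts_freely_on (Borel A) (KH A),
      acts_transitively_on (Borel A) (KH A) &
      acts_transitively_on (UthetaH A) (KH A)] /\
  (* (2) *)
  Cinf_submanifold (KH A : set A2) /\
  (* (3) *)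
  [/\ Cinf_from_submanifold (KH A : set A2)
        (phi (A := A) : A2 -> realified A),
      forall x, KH A x -> upper_half A (phi x),
      forall h, upper_half A h -> exists2 x, KH A x & phi x = h &
      exists2 sigma : realified A -> A2,
        Cinf_to_submanifold (upper_half A : set (realified A))
          (KH A : set A2) sigma &
        forall h, upper_half A h -> phi (A := A) (sigma h) = h] /\
  (* (4) *)
  forall (a : 'M[A]_2) (b : A * A), UthetaH A a -> KH A b ->
    [/\ KH A (mulmv a b), a 0 0 + a 0 1 * phi b \is a GRing.unit &
        phi (mulmv a b) = moebius a (phi b)].
Proof.
have Borel_acts : acts_on (Borel A) (KH A).
  by move=> b x [bU _]; exact: UthetaH_acts.
split.
  split; first exact: subgroup_Borel.
  - by split=> // b x; exact: Borel_free.
  - by split=> // x y; exact: Borel_transitive.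
  - split; first exact: UthetaH_acts.
    by move=> x y Kx Ky; have [b [bU _] bx] := Borel_transitive Kx Ky; exists b.
split; first exact: KH_submanifold.
split; last by move=> a b; exact: UthetaH_covariant.
split.
- exact: phi_Cinf.
- exact: phi_upper_half.
- by move=> h /KH_sectionP[Kh <-]; exists (KH_section h).
- by exists (@KH_section R A); [exact: KH_section_Cinf|move=> h /KH_sectionP[]].
Qed.
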